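(* Let $p>1$, $p\ne 2$. Let $n\ge2$, let $m$ be a positive integer and $m_1\le m_2$ positive integers with $n=\tfrac12(m_1+m_2)m+2$, and let $\phi$ be a homogeneous polynomial on $\mathbb{R}^n$ of degree $m$ satisfying $|\nabla\phi(x)|^2=m^2|x|^{2m-2}$ and $\Delta\phi(x)=\tfrac12(m_2-m_1)m^2|x|^{m-2}$. Then there is no homogeneous polynomial $u$ on $\mathbb{R}^n$ with $\deg u\ge 2$ which satisfies $\Delta_p u=0$ and has the form $u(x)=f(|x|^m,\phi(x))$ for some $C^2$ function $f(s,t)$.
   Context: The $p$-Laplacian of a $C^2$ function $u$ is $\Delta_p u:=|\nabla u|^2\Delta u+\tfrac{p-2}{2}\nabla u\cdot\nabla|\nabla u|^2$. *)

(* Defs.v *)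
From HB Require Import structures.
From mathcomp Require Import all_boot all_order all_algebra.
From mathcomp Require Import mpoly.
From mathcomp Require Import all_classical all_reals all_analysis.
Set Implicit Arguments. Unset Strict Implicit. Unset Printing Implicit Defensive.
Import Order.TTheory GRing.Theory Num.Theory.
Import numFieldNormedType.Exports.
Local Open Scope ring_scope.

Notation Poly R n := {mpoly R[n]}.

Definition is_homog {R : realType} {n : nat} (d : nat) (p : Poly R n) : bool :=
  p \is d.-homog.

Definition ev {R : realType} {n : nat} (p : Poly R n) (x : 'I_n -> R) : R :=
  p.@[x].

Definition pd {R : realType} {n : nat} (i : 'I_n) (p : Poly R n) : Poly R n :=
  mderiv i p.

Definition gradsq {R : realType} {n : nat} (p : Poly R n) : Poly R n :=
  \sum_(i < n) pd i p * pd i p.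

Definition lap {R : realType} {n : nat} (p : Poly R n) : Poly R n :=
  \sum_(i < n) pd i (pd i p).

Definition plap {R : realType} {n : nat} (p : R) (u : Poly R n) : Poly R n :=
  gradsq u * lap u + ((p - 2) / 2) *: \sum_(j < n) pd j u * pd j (gradsq u).

Definition enorm {R : realType} {n : nat} (x : 'I_n -> R) : R :=
  Num.sqrt (\sum_(i < n) x i ^+ 2).

Definition pd_s {R : realType} (g : R * R -> R) (z : R * R) : R :=
  derive1 (fun s => g (s, z.2)) z.1.
Definition pd_t {R : realType} (g : R * R -> R) (z : R * R) : R :=
  derive1 (fun t => g (z.1, t)) z.2.

Definition has_partials {R : realType} (g : R * R -> R) : Prop :=
  forall z : R * R,
    derivable (fun s => g (s, z.2)) z.1 1 /\ derivable (fun t => g (z.1, t)) z.2 1.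

Definition C2 {R : realType} (f : R * R -> R) : Prop :=
  has_partials f /\ has_partials (pd_s f) /\ has_partials (pd_t f) /\
  continuous f /\ continuous (pd_s f) /\ continuous (pd_t f) /\
  continuous (pd_s (pd_s f)) /\ continuous (pd_t (pd_s f)) /\
  continuous (pd_s (pd_t f)) /\ continuous (pd_t (pd_t f)).

(* Main.v *)
(** On the unit sphere [u] is a function of [phi], and [phi] restricted to a
suitable plane through 0 is [Re (z ^+ m)]; there [u] is a trigonometric
polynomial, and the symmetries of [Re (z ^+ m)] force [u = r^d G(phi / r^m)] for
a polynomial [G]. The p-Laplace equation becomes a polynomial differential
equation for [G] and [P = d^2 G^2 + m^2 (1 - t^2) G'^2], the squared gradient on
the sphere. Comparing orders of vanishing, [P] has no complex zero, so it is
constant, and leading coefficients then force [d (d - 1) = 0]. *)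
Require Import Defs.
From HB Require Import structures.
From mathcomp Require Import all_boot all_order all_algebra.
From mathcomp Require Import mpoly.
From mathcomp Require Import all_classical all_reals all_analysis.
From mathcomp Require Import complex ring lra zify.
From mathcomp Require Import cyclic separable cyclotomic.
Import Order.TTheory GRing.Theory Num.Theory.
Import numFieldNormedType.Exports.
Local Open Scope ring_scope.

Set Implicit Arguments.
Unset Strict Implicit.
Unset Printing Implicit Defensive.

(** * Multivariate polynomials as functions *)

(** The zeros of [P] that have to be excluded are complex, so [G] must be known to be a polynomial
    before the equation, valid at first only at the values of [phi] on the sphere, can be read at
    them. The plane is spanned by a unit vector [x0] with phi(x0)^2 <> 1 and the direction of the
    spherical gradient at [x0]; the identity for |grad phi|^2 forces the gradient to stay in this
    plane. Put c = (p - 2) / 2. Then p > 1 means 1 + 2c > 0, and the relation between n, m, m1, m2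
    turns the lowest-order coefficients at t = 1 and t = -1 into positive multiples of (2k + 1)(p -
    1) + m1 and (2k + 1)(p - 1) + m2. Once [P] is constant and [G] is not, P' = 0 is Chebyshev's
    equation and gives d = m deg G. For this d the ordinary Laplacian contributes nothing in top
    degree, so only 2 c d (d - 1) remains, and p <> 2 means c <> 0. *)

Lemma mpoly_alg_ind (n : nat) (K : comNzRingType) (P : {mpoly K[n]} -> Prop) :
  (forall c, P c%:MP) -> (forall i, P 'X_i) ->
  (forall p q, P p -> P q -> P (p + q)) ->
  (forall p q, P p -> P q -> P (p * q)) -> forall p, P p.
Proof.
move=> PC PX PD PM; apply: mpolyind => [|c m p _ _ Pp]; first by rewrite -mpolyC0.
apply: PD => //; rewrite -mul_mpolyC; apply: (PM) => //.
rewrite mpolyXE_id; apply: big_ind => [||i _]; [exact: (PC 1) | exact: (PM) |].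
by elim: (m i) => [|k IH]; [exact: (PC 1) | rewrite exprS; apply: (PM)].
Qed.

Lemma poly_eq0_seq (K : idomainType) (s : nat -> K) (p : {poly K}) :
  injective s -> (forall k, p.[s k] = 0) -> p = 0.
Proof.
move=> injs H; apply/eqP; apply: contraT => p0.
have := @max_poly_roots _ p (map s (iota 0 (size p))) p0.
rewrite size_map size_iota ltnn; apply; last by rewrite map_inj_uniq ?iota_uniq.
by apply/allP => x /mapP[k _ ->]; apply/rootP/H.
Qed.

Lemma poly_eq0_nat (K : numDomainType) (p : {poly K}) :
  (forall k : nat, p.[k.+1%:R] = 0) -> p = 0.
Proof.
by apply: poly_eq0_seq => i j /eqP; rewrite eqr_nat => /eqP[].
Qed.

(** Restriction to the line a + t v, as a ring morphism into one-variable polynomials, where root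
    counting and comparison of coefficients are available. *)
Definition line_mpoly (K : comNzRingType) (n : nat) (a v : 'I_n -> K) :
    {mpoly K[n]} -> {poly K} :=
  mmap (@polyC K) (fun i => (a i)%:P + v i *: 'X).
HB.instance Definition _ (K : comNzRingType) (n : nat) (a v : 'I_n -> K) :=
  GRing.RMorphism.on (@line_mpoly K n a v).

Lemma line_mpolyC (K : comNzRingType) n (a v : 'I_n -> K) c :
  line_mpoly a v c%:MP = c%:P.
Proof. exact: mmapC. Qed.

Lemma line_mpolyX (K : comNzRingType) n (a v : 'I_n -> K) i :
  line_mpoly a v 'X_i = (a i)%:P + v i *: 'X.
Proof. by rewrite /line_mpoly mmapX mmap1U. Qed.

Lemma horner_line_mpoly (K : comNzRingType) n (a v : 'I_n -> K) p t :
  (line_mpoly a v p).[t] = p.@[fun i => a i + v i * t].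
Proof.
elim/mpoly_alg_ind: p => [c|i|p q Hp Hq|p q Hp Hq].
- by rewrite line_mpolyC hornerC mevalC.
- by rewrite line_mpolyX !hornerE mevalXU.
- by rewrite rmorphD hornerD Hp Hq mevalD.
- by rewrite rmorphM hornerM Hp Hq mevalM.
Qed.

Lemma mderivXU (K : comNzRingType) n (i j : 'I_n) :
  mderiv i ('X_j : {mpoly K[n]}) = (j == i)%:R.
Proof.
rewrite mderivX mnm1E; case: eqP => [->|_]; last by rewrite scale0r.
by rewrite scale1r -[X in (X - _)%MM]add0m addmK mpolyX0.
Qed.

Lemma deriv_line_mpoly (K : comNzRingType) n (a v : 'I_n -> K) p :
  (line_mpoly a v p)^`() = \sum_i v i *: line_mpoly a v (mderiv i p).
Proof.
elim/mpoly_alg_ind: p => [c|i|p q Hp Hq|p q Hp Hq].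
- rewrite line_mpolyC derivC big1 // => i _.
  by rewrite mderivC rmorph0 scaler0.
- rewrite line_mpolyX derivD derivC derivZ derivX add0r.
  rewrite (bigD1 i) //= mderivXU eqxx rmorph1.
  rewrite big1 ?addr0 // => j /negbTE; rewrite mderivXU eq_sym => ->.
  by rewrite rmorph0 scaler0.
- rewrite rmorphD derivD Hp Hq -big_split; apply: eq_bigr => i _ /=.
  by rewrite -scalerDr -rmorphD mderivD.
- rewrite rmorphM derivM Hp Hq mulr_suml mulr_sumr -big_split.
  apply: eq_bigr => i _ /=; rewrite mderivM rmorphD !rmorphM.
  by rewrite scalerDr scalerAl scalerAr.
Qed.

(** The restriction to a coordinate line has infinitely many roots, so it is the zero polynomial and
    its derivative vanishes too. *)
Lemma mderiv_vanish (K : numDomainType) n (p : {mpoly K[n]}) i :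
  (forall x, p.@[x] = 0) -> forall x, (mderiv i p).@[x] = 0.
Proof.
move=> H x; pose e := fun j : 'I_n => (j == i)%:R : K.
have L0 : line_mpoly x e p = 0.
  by apply: poly_eq0_nat => k; rewrite horner_line_mpoly.
have /(congr1 (fun q : {poly K} => q.[0])) := deriv_line_mpoly x e p.
rewrite L0 derivC horner0 horner_sum (bigD1 i) //= big1 ?addr0 => [|j /negbTE ji].
  rewrite /e eqxx scale1r horner_line_mpoly => h; rewrite [RHS]h.
  by apply: meval_eq => j; rewrite mulr0 addr0.
by rewrite /e ji scale0r horner0.
Qed.

(** Induction on the size: the partial derivatives vanish everywhere and are smaller, hence zero,
    and in characteristic 0 this leaves only a constant. *)
Lemma mpoly_eq0_meval (K : numDomainType) n (p : {mpoly K[n]}) :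
  (forall x, p.@[x] = 0) -> p = 0.
Proof.
have [k] := ubnP (msize p); elim: k p => // k IH p /ltnSE sp H.
have dp i : mderiv i p = 0.
  have [//|p0] := eqVneq (mderiv i p) 0.
  apply: IH; last exact: mderiv_vanish.
  apply: leq_trans sp; case sps: (msize p) => [|s].
    by move/eqP: sps; rewrite msize_poly_eq0 => /eqP pp; rewrite pp mderiv0 eqxx in p0.
  have := mlead_supp p0; rewrite mcoeff_msupp mcoeff_mderiv => cf.
  have: (mlead (mderiv i p) + U_(i))%MM \in msupp p.
    by rewrite mcoeff_msupp; apply: contraNneq cf => ->; rewrite mul0rn.
  move/msize_mdeg_lt; rewrite mdegD mdeg1 addn1 => h.
  by rewrite -(mlead_deg p0) -sps; exact: h.
have pE : p = (p@_0)%:MP.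
  apply/mpolyP => m; rewrite mcoeffC; have [->|m0] := eqVneq m 0%MM; first by rewrite mulr1.
  have [i mi] : exists i, (m i != 0)%N.
    apply/existsP; apply: contraNT m0; rewrite negb_exists => /forallP h.
    by apply/eqP/mnmP => i; rewrite mnm0E; apply/eqP; move: (h i); rewrite negbK.
  have /(congr1 (mcoeff (m - U_(i))%MM)) := dp i.
  rewrite mcoeff_mderiv mcoeff0 submK ?lep1mP // => /eqP.
  by rewrite mulrn_eq0 /= => /eqP->; rewrite mulr0.
by have := H (fun=> 0); rewrite pE mevalC => ->; rewrite mpolyC0.
Qed.

Lemma mpoly_eq_meval (K : numDomainType) n (p q : {mpoly K[n]}) :
  (forall x, p.@[x] = q.@[x]) -> p = q.
Proof.
move=> H; apply/eqP; rewrite -subr_eq0; apply/eqP/mpoly_eq0_meval => x.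
by rewrite mevalB H subrr.
Qed.

(** Stated for [mmap] because it is also applied to real coefficients at a complex point, in
    [circle_poly]. *)
Lemma mmap_homog (n d : nat) (K : nzRingType) (S : comNzRingType) (f : {rmorphism K -> S})
    (h : 'I_n -> S) c (p : {mpoly K[n]}) :
  p \is d.-homog -> mmap f (fun i => c * h i) p = c ^+ d * mmap f h p.
Proof.
move=> /dhomogP hp; rewrite /mmap mulr_sumr; apply: eq_big_seq => m /hp /= <-.
rewrite [X in c ^+ X]mdegE mulrCA; congr (_ * _).
by rewrite /mmap1 expr_sum -big_split; apply: eq_bigr => i _; rewrite exprMn.
Qed.

Lemma meval_homog (n d : nat) (K : comNzRingType) (p : {mpoly K[n]}) c x :
  p \is d.-homog -> p.@[fun i => c * x i] = c ^+ d * p.@[x].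
Proof. exact: mmap_homog. Qed.

Lemma dhomog_mderiv (n d : nat) (K : numDomainType) (p : {mpoly K[n]}) i :
  p \is d.-homog -> mderiv i p \is d.-1.-homog.
Proof.
move=> /dhomogP hp; apply/dhomogP => m.
rewrite mcoeff_msupp mcoeff_mderiv mulrn_eq0 /= => h.
by rewrite -(hp (m + U_(i))%MM) ?mcoeff_msupp //= mdegD mdeg1 addn1.
Qed.

(** On the ray through [x] the polynomial is p(x) t^d; differentiate at t = 1. *)
Lemma euler_homog (n d : nat) (K : numDomainType) (p : {mpoly K[n]}) :
  p \is d.-homog -> \sum_i 'X_i * mderiv i p = d%:R *: p.
Proof.
move=> hp; apply: mpoly_eq_meval => x.
have L : line_mpoly (fun=> 0) x p = p.@[x] *: 'X^d.
  apply/eqP; rewrite -subr_eq0; apply/eqP/poly_eq0_nat => k.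
  rewrite hornerD hornerN hornerZ hornerXn horner_line_mpoly.
  have -> : p.@[fun i => 0 + x i * k.+1%:R] = p.@[fun i => k.+1%:R * x i].
    by apply: meval_eq => i; rewrite add0r mulrC.
  by rewrite (meval_homog _ _ hp) mulrC subrr.
have /(congr1 (fun q : {poly K} => q.[1])) := deriv_line_mpoly (fun=> 0) x p.
rewrite L derivZ derivXn mevalZ hornerZ hornerMn hornerXn expr1n mulrC => ->.
rewrite horner_sum raddf_sum /=; apply: eq_bigr => i _.
rewrite mevalM mevalXU hornerZ horner_line_mpoly; congr (_ * _).
by apply: meval_eq => j; rewrite /= mulr1 add0r.
Qed.

(** * Functions of [r] and [phi] on the unit sphere *)

(** With equal arguments this is convertible to [gradsq], as [mlap] is to [lap]. Two arguments are
    needed for the Laplacian of a product and for the term grad u . grad |grad u|^2. *)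
Definition mgradprod (K : comNzRingType) n (p q : {mpoly K[n]}) : {mpoly K[n]} :=
  \sum_(i < n) mderiv i p * mderiv i q.
Definition mlap (K : comNzRingType) n (p : {mpoly K[n]}) : {mpoly K[n]} :=
  \sum_(i < n) mderiv i (mderiv i p).
Definition rho (K : comNzRingType) n : {mpoly K[n]} := \sum_(i < n) 'X_i * 'X_i.
Arguments rho {K n}.

Lemma mlapM (K : comNzRingType) n (p q : {mpoly K[n]}) :
  mlap (p * q) = p * mlap q + q * mlap p + 2%:R *: mgradprod p q.
Proof.
rewrite /mlap /mgradprod scaler_sumr !mulr_sumr -!big_split.
by apply: eq_bigr => i _ /=; rewrite !(mderivM, mderivD) scaler_nat; ring.
Qed.

Lemma mlapD (K : comNzRingType) n (p q : {mpoly K[n]}) : mlap (p + q) = mlap p + mlap q.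
Proof. by rewrite /mlap -big_split; apply: eq_bigr => i _ /=; rewrite !mderivD. Qed.

Lemma mlapZ (K : comNzRingType) n c (p : {mpoly K[n]}) : mlap (c *: p) = c *: mlap p.
Proof. by rewrite /mlap scaler_sumr; apply: eq_bigr => i _ /=; rewrite !mderivZ. Qed.

Lemma meval_rho (K : comNzRingType) n (x : 'I_n -> K) : rho.@[x] = \sum_i x i ^+ 2.
Proof.
by rewrite /rho raddf_sum /=; apply: eq_bigr => i _; rewrite mevalM !mevalXU expr2.
Qed.

Lemma mderiv_rho (K : comNzRingType) n (i : 'I_n) :
  mderiv i (rho : {mpoly K[n]}) = 'X_i *+ 2.
Proof.
rewrite /rho raddf_sum /= (bigD1 i) //= big1 ?addr0 => [|j ji].
  by rewrite mderivM mderivXU eqxx mul1r mulr1 mulr2n.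
by rewrite mderivM mderivXU (negbTE ji) mul0r mulr0 addr0.
Qed.

Lemma dhomogXi (K : nzRingType) n (i : 'I_n) : ('X_i : {mpoly K[n]}) \is 1.-homog.
Proof. by rewrite dhomogX /= mdeg1. Qed.

Lemma rho_homog (K : comNzRingType) n : (rho : {mpoly K[n]}) \is 2.-homog.
Proof.
by apply: rpred_sum => i _; apply: (dhomogM (d := 1) (e := 1)); apply: dhomogXi.
Qed.

Lemma rho_neq0 (K : numDomainType) n : (0 < n)%N -> (rho : {mpoly K[n]}) != 0.
Proof.
move=> n0; apply/eqP => /(congr1 (meval (fun=> 1))) /eqP.
rewrite meval_rho meval0; under eq_bigr do rewrite expr1n.
by rewrite sumr_const card_ord pnatr_eq0 -leqn0 leqNgt n0.
Qed.

(** Any point except 0 scales onto the sphere. Multiplying the difference by [rho] takes care of 0,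
    and [rho] then cancels in the integral domain. *)
Lemma homog_eq_sphere (R : rcfType) n D (s q : {mpoly R[n]}) :
  (rho : {mpoly R[n]}) != 0 -> s \is D.-homog -> q \is D.-homog ->
  (forall x, rho.@[x] = 1 -> s.@[x] = q.@[x]) -> s = q.
Proof.
move=> rho0 hs hq sq.
apply/eqP; rewrite -subr_eq0; have /eqP : (s - q) * rho = 0.
  apply: mpoly_eq0_meval => x; rewrite mevalM mevalB.
  have [->|r0] := eqVneq rho.@[x] 0; first by rewrite mulr0.
  have rp : 0 < rho.@[x].
    by rewrite lt0r r0 meval_rho sumr_ge0 // => i _; apply: sqr_ge0.
  pose r := Num.sqrt rho.@[x]; have rn0 : r != 0 by rewrite gt_eqF // sqrtr_gt0.
  pose y i := r^-1 * x i.
  have xE (p : {mpoly R[n]}) : p.@[x] = p.@[fun i => r * y i].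
    by apply: meval_eq => i; rewrite /y mulVKf.
  have y1 : rho.@[y] = 1.
    rewrite /y (meval_homog _ _ (rho_homog _ _)) exprVn sqr_sqrtr ?mulVf //.
    exact: ltW.
  by rewrite !xE (meval_homog _ _ hq) (meval_homog _ _ hs) sq // subrr mul0r.
by rewrite mulf_eq0 (negbTE rho0) orbF.
Qed.

Section Isoparametric.
Variables (R : realFieldType) (n m : nat) (phi : {mpoly R[n]}) (beta : R).

(* [sphere_rep D q Q] encodes [q = r^D Q(phi / r^m)] through its first and second
order consequences on the unit sphere; [sphere_lap D Q] is the Laplacian of such
a function, as a polynomial in [phi]. *)
Definition sphere_lap D (Q : {poly R}) : {poly R} :=
  (m%:R ^+ 2)%:P * (1 - 'X^2) * Q^`()^`()
  + (beta%:P - (m%:R * (m%:R + n%:R - 2))%:P * 'X) * Q^`()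
  + (D%:R * (D%:R + n%:R - 2))%:P * Q.

Record sphere_rep D (q : {mpoly R[n]}) (Q : {poly R}) : Prop := SphereRep {
  srep_homog : q \is D.-homog;
  srep_val : forall x, rho.@[x] = 1 -> q.@[x] = Q.[phi.@[x]];
  srep_grad : forall x i, rho.@[x] = 1 -> (mderiv i q).@[x] =
    (D%:R * Q.[phi.@[x]] - m%:R * phi.@[x] * Q^`().[phi.@[x]]) * x i
    + Q^`().[phi.@[x]] * (mderiv i phi).@[x];
  srep_lap : forall x, rho.@[x] = 1 ->
    (mlap q).@[x] = (sphere_lap D Q).[phi.@[x]] }.

(** On the sphere the factor |x|^(m-2) of the Laplacian, not a polynomial for odd m, becomes 1. *)
Definition isoparametric :=
  [/\ phi \is m.-homog, forall x, rho.@[x] = 1 -> (mgradprod phi phi).@[x] = m%:R ^+ 2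
    & forall x, rho.@[x] = 1 -> (mlap phi).@[x] = beta].

Hypothesis phiP : isoparametric.

Lemma isoparametric_euler x : \sum_i x i * (mderiv i phi).@[x] = m%:R * phi.@[x].
Proof.
case: phiP => hom _ _; have /(congr1 (meval x)) := euler_homog hom.
rewrite mevalZ raddf_sum /= => <-; apply: eq_bigr => i _.
by rewrite mevalM mevalXU.
Qed.

Lemma sum_lincomb2 (a b c d : R) (x y : 'I_n -> R) :
  \sum_i (a * x i + b * y i) * (c * x i + d * y i) =
  a * c * (\sum_i x i ^+ 2) + (a * d + b * c) * (\sum_i x i * y i)
  + b * d * (\sum_i y i * y i).
Proof. by rewrite !mulr_sumr -!big_split; apply: eq_bigr => i _ /=; ring. Qed.

(** The gradient of [q] is D Q x plus Q' times the tangential vector grad phi - m phi x, whose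
    squared length is m^2 (1 - phi^2). *)
Lemma mgradprod_rep D E q s Q S x : sphere_rep D q Q -> sphere_rep E s S ->
  rho.@[x] = 1 -> (mgradprod q s).@[x] =
  D%:R * E%:R * Q.[phi.@[x]] * S.[phi.@[x]]
  + m%:R ^+ 2 * (1 - phi.@[x] ^+ 2) * Q^`().[phi.@[x]] * S^`().[phi.@[x]].
Proof.
move=> hq hs x1; rewrite /mgradprod raddf_sum /=.
under eq_bigr do rewrite mevalM (srep_grad hq) // (srep_grad hs) //.
rewrite sum_lincomb2 -meval_rho x1 isoparametric_euler.
have -> : \sum_i (mderiv i phi).@[x] * (mderiv i phi).@[x] = m%:R ^+ 2.
  case: phiP => _ /(_ x x1) <- _; rewrite /mgradprod raddf_sum.
  by apply: eq_bigr => i _; rewrite /= mevalM.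
ring.
Qed.

(** With the closure lemmas below and the cases of [rho] and [phi], the derivatives of any
    polynomial assembled from [rho] and [phi] are known on the sphere. *)
Lemma srepM D E q s Q S : sphere_rep D q Q -> sphere_rep E s S ->
  sphere_rep (D + E) (q * s) (Q * S).
Proof.
move=> hq hs; split.
- by apply: dhomogM; [case: hq | case: hs].
- by move=> x x1; rewrite mevalM hornerM (srep_val hq) // (srep_val hs).
- move=> x i x1; rewrite mderivM mevalD !mevalM derivM hornerD !hornerM natrD.
  rewrite (srep_val hq) // (srep_val hs) // (srep_grad hq) // (srep_grad hs) //.
  ring.
- move=> x x1; rewrite mlapM !mevalD !mevalM mevalZ (mgradprod_rep hq hs) //.
  rewrite (srep_val hq) // (srep_val hs) // (srep_lap hq) // (srep_lap hs) //.
  rewrite /sphere_lap !(derivM, derivD, hornerD, hornerM, hornerN, hornerC, hornerX, hornerXn) natrD.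
  ring.
Qed.

Lemma srepD D q s Q S : sphere_rep D q Q -> sphere_rep D s S ->
  sphere_rep D (q + s) (Q + S).
Proof.
move=> hq hs; split.
- by apply: dhomogD; [case: hq | case: hs].
- by move=> x x1; rewrite mevalD hornerD (srep_val hq) // (srep_val hs).
- move=> x i x1; rewrite mderivD mevalD derivD !hornerD.
  by rewrite (srep_grad hq) // (srep_grad hs) //; ring.
- move=> x x1; rewrite mlapD !mevalD (srep_lap hq) // (srep_lap hs) //.
  rewrite /sphere_lap !derivD !(hornerD, hornerM, hornerN, hornerC, hornerX, hornerXn).
  ring.
Qed.

Lemma srepZ D c q Q : sphere_rep D q Q -> sphere_rep D (c *: q) (c *: Q).
Proof.
move=> hq; split.
- by apply: dhomogZ; case: hq.
- by move=> x x1; rewrite mevalZ hornerZ (srep_val hq).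
- move=> x i x1; rewrite mderivZ mevalZ derivZ !hornerZ (srep_grad hq) //; ring.
- move=> x x1; rewrite mlapZ !mevalZ (srep_lap hq) //.
  rewrite /sphere_lap !derivZ !(hornerD, hornerM, hornerN, hornerC, hornerX, hornerXn, hornerZ).
  ring.
Qed.

Lemma srep0 D : sphere_rep D 0 0.
Proof.
split; first exact: dhomog0.
- by move=> x _; rewrite meval0 horner0.
- by move=> x i _; rewrite mderiv0 meval0 derivC !horner0; ring.
- move=> x _; rewrite /mlap big1 => [|i _]; last by rewrite !mderiv0.
  by rewrite /sphere_lap !derivC !mulr0 !addr0 meval0 horner0.
Qed.

Lemma srep1 : sphere_rep 0 1 1.
Proof.
split; first exact: dhomog1.
- by move=> x _; rewrite meval1 hornerC.
- by move=> x i _; rewrite -mpolyC1 mderivC meval0 derivC !hornerC; ring.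
- move=> x _; rewrite /mlap big1 => [|i _]; last by rewrite -mpolyC1 mderivC ?mderiv0.
  by rewrite /sphere_lap !derivC !mulr0 !add0r meval0 !hornerE.
Qed.

Lemma srep_rho : sphere_rep 2 rho 1.
Proof.
split; first exact: rho_homog.
- by move=> x ->; rewrite hornerC.
- by move=> x i _; rewrite mderiv_rho mevalMn mevalXU derivC !hornerC; ring.
- move=> x _; rewrite /mlap.
  under eq_bigr do rewrite mderiv_rho mderivMn mderivXU eqxx.
  rewrite sumr_const card_ord !mevalMn meval1 /sphere_lap !derivC !mulr0 !add0r !hornerE.
  rewrite -[2 *+ n]mulr_natr; ring.
Qed.

Lemma srep_phi : sphere_rep m phi 'X.
Proof.
case: phiP => hom _ hlap; split => //.
- by move=> x _; rewrite hornerX.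
- by move=> x i _; rewrite derivX !hornerE; ring.
- by move=> x x1; rewrite hlap // /sphere_lap derivX derivC !hornerE; ring.
Qed.

Lemma srepX D q Q k : sphere_rep D q Q -> sphere_rep (k * D) (q ^+ k) (Q ^+ k).
Proof.
move=> hq; elim: k => [|k IH]; first exact: srep1.
by rewrite mulSn !exprS; apply: srepM.
Qed.

End Isoparametric.

(** * The differential equation of the profile *)

Lemma deriv_XsubC_expM (K : comNzRingType) (t : K) k (A : {poly K}) :
  (('X - t%:P) ^+ k.+1 * A)^`() =
  ('X - t%:P) ^+ k * (('X - t%:P) * A^`() + k.+1%:R%:P * A).
Proof.
rewrite polyC_natr derivM deriv_exp derivXsubC mul1r /= exprSr -mulr_natr; ring.
Qed.

Lemma mul_deriv_XsubC_expM (K : comNzRingType) (t : K) k (A : {poly K}) :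
  ('X - t%:P) * (('X - t%:P) ^+ k * A)^`() =
  ('X - t%:P) ^+ k * (('X - t%:P) * A^`() + k%:R%:P * A).
Proof.
case: k => [|k]; first by rewrite expr0 !mul1r mul0r addr0.
by rewrite deriv_XsubC_expM exprS mulrA.
Qed.

Lemma poly_factor_root (K : fieldType) (p : {poly K}) t : p != 0 -> root p t ->
  exists k q, p = ('X - t%:P) ^+ k.+1 * q /\ q.[t] != 0.
Proof.
move=> p0 pt; have [k [q /implyP/(_ p0) qt pE]] := multiplicity_XsubC p t.
case: k pE => [|k] pE; first by rewrite pE mulr1 (negbTE qt) in pt.
by exists k, q; rewrite mulrC.
Qed.

(* At a zero [t] of [P], let [a] be the order of vanishing of [G]. The
lowest-order coefficient of the equation is a non-zero multiple of
[(a - 1) (1 + 2c)] if [t^2 <> 1], and of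
[(2a - 1) (1 + 2c) mu^2 + nu - mu^2 -+ beta] if [t = +-1]; when [G'(t) <> 0] and
[t^2 <> 1] it is the order of [P] that matters. *)
Lemma cone_ode_no_root (K : numFieldType) (mu del beta nu lam c t : K) (G P : {poly K}) :
  mu != 0 -> del != 0 -> c != 0 -> 1 + c * 2 != 0 ->
  (forall k : nat, (2 * k + 1)%:R * (1 + c * 2) * mu ^+ 2 + (nu - mu ^+ 2 - beta) != 0) ->
  (forall k : nat, (2 * k + 1)%:R * (1 + c * 2) * mu ^+ 2 + (nu - mu ^+ 2 + beta) != 0) ->
  P = (del ^+ 2)%:P * G ^+ 2 + (mu ^+ 2)%:P * (1 - 'X^2) * G^`() ^+ 2 ->
  P * ((mu ^+ 2)%:P * (1 - 'X^2) * G^`()^`() + (beta%:P - nu%:P * 'X) * G^`() + lam%:P * G)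
    + (c * mu ^+ 2)%:P * (1 - 'X^2) * G^`() * P^`() = 0 ->
  P != 0 -> P.[t] != 0.
Proof.
move=> mu0 del0 c0 p1 hm hp PE ode P0; apply/negP => /eqP Pt.
have [X XE] : exists X, X = 'X - t%:P by eexists.
have X0 : X != 0 by rewrite XE polyXsubC_eq0.
have Xt : X.[t] = 0 by rewrite XE !hornerE subrr.
have G0 : G != 0.
  by apply: contraNneq P0 => G0; rewrite PE G0 derivC !expr0n !mulr0 addr0.
have cancel k A : X ^+ k * A = 0 -> A.[t] = 0.
  by move=> /eqP; rewrite mulf_eq0 expf_eq0 (negbTE X0) andbF => /eqP->; rewrite horner0.
have Pt' : del ^+ 2 * G.[t] ^+ 2 + mu ^+ 2 * (1 - t ^+ 2) * G^`().[t] ^+ 2 = 0.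
  by rewrite -Pt PE !hornerE.
have dX k A : (X ^+ k.+1 * A)^`() = X ^+ k * (X * A^`() + k.+1%:R%:P * A).
  by rewrite XE deriv_XsubC_expM.
have mdX k A : X * (X ^+ k * A)^`() = X ^+ k * (X * A^`() + k%:R%:P * A).
  by rewrite XE mul_deriv_XsubC_expM.
have [t1|t1] := eqVneq (t ^+ 2) 1.
- have Gt : root G t.
    move: Pt'; rewrite t1 subrr mulr0 mul0r addr0 => /eqP.
    by rewrite mulf_eq0 !expf_eq0 (negbTE del0).
  have [k [G1 [GE G1t]]] := poly_factor_root G0 Gt; rewrite -XE in GE.
  pose G2 := X * G1^`() + k.+1%:R%:P * G1.
  have dG : G^`() = X ^+ k * G2 by rewrite GE dX.
  pose G3 := X * G2^`() + k%:R%:P * G2.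
  (* [G''] enters the equation only through (1 - t^2) G'', which supplies the extra factor [X]; this
     also covers a simple zero, k = 0. *)
  have ddG : X * G^`()^`() = X ^+ k * G3 by rewrite dG mdX.
  have X2 : 1 - 'X^2 = - (X * (X + (t + t)%:P)).
    rewrite XE -[1 in LHS]/(1%:P) -t1 polyCD rmorphXn /=; ring.
  pose P2 := (del ^+ 2)%:P * X * G1 ^+ 2 - (mu ^+ 2)%:P * (X + (t + t)%:P) * G2 ^+ 2.
  have PE2 : P = X ^+ (2 * k).+1 * P2.
    rewrite PE dG X2 GE /P2 !exprS mulnC exprM; ring.
  have dP : P^`() = X ^+ (2 * k) * (X * P2^`() + (2 * k).+1%:R%:P * P2).
    by rewrite PE2 dX.
  have /cancel : X ^+ (3 * k).+1 * (P2 * (- (mu ^+ 2)%:P * (X + (t + t)%:P) * G3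
       + (beta%:P - nu%:P * 'X) * G2 + lam%:P * X * G1)
     - (c * mu ^+ 2)%:P * (X + (t + t)%:P) * G2
       * (X * P2^`() + (2 * k).+1%:R%:P * P2)) = 0.
    rewrite -[RHS]ode.
    transitivity (P * (- (mu ^+ 2)%:P * (X + (t + t)%:P) * (X * G^`()^`())
       + (beta%:P - nu%:P * 'X) * G^`() + lam%:P * G)
       - (c * mu ^+ 2)%:P * (X + (t + t)%:P) * X * G^`() * P^`()).
      rewrite ddG dP dG PE2 GE !exprS ![(_ * k)%N]mulnC !exprM; ring.
    rewrite X2; ring.
  have G2t : G2.[t] = k.+1%:R * G1.[t].
    by rewrite !(hornerD, hornerM, hornerC) Xt mul0r add0r.
  have G3t : G3.[t] = k%:R * G2.[t].
    by rewrite !(hornerD, hornerM, hornerC) Xt mul0r add0r.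
  have G2t0 : G2.[t] != 0 by rewrite G2t mulf_neq0 // pnatr_eq0.
  have P2t : P2.[t] = - (mu ^+ 2 * (t + t) * G2.[t] ^+ 2).
    by rewrite !(hornerD, hornerN, hornerM, hornerC, horner_exp) Xt; ring.
  have t0 : t != 0 by apply: contra_eq_neq t1 => ->; rewrite expr0n eq_sym oner_eq0.
  have P2t0 : P2.[t] != 0.
    by rewrite P2t oppr_eq0 -mulr2n !mulf_neq0 ?expf_neq0 ?mulrn_eq0.
  clearbody P2 G3 G2.
  rewrite !(hornerD, hornerN, hornerM, hornerC, hornerX) Xt G3t => H.
  have {}H : P2.[t] * G2.[t] * (- (mu ^+ 2 * (t + t) * k%:R) + (beta - nu * t)
     - c * mu ^+ 2 * (t + t) * (2 * k).+1%:R) = 0 by rewrite -[RHS]H; ring.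
  move/eqP: H; rewrite mulf_eq0 mulf_eq0 (negbTE P2t0) (negbTE G2t0) /= => /eqP H.
  have /orP[/eqP tE|/eqP tE] : (t == 1) || (t == -1).
    by rewrite -sqrf_eq1 t1.
  + move/eqP: (hm k); apply; rewrite -[RHS]oppr0 -[in RHS]H tE addn1.
    rewrite -[(2 * k).+1]addn1 natrD natrM; ring.
  + move/eqP: (hp k); apply; rewrite -[RHS]H tE -[(2 * k).+1]addn1 natrD natrM; ring.
- have t10 : 1 - t ^+ 2 != 0 by rewrite subr_eq0 eq_sym.
  have [dGt|dGt] := eqVneq G^`().[t] 0.
  + have Gt : root G t.
      move: Pt'; rewrite dGt expr0n mulr0 addr0 => /eqP.
      by rewrite mulf_eq0 !expf_eq0 (negbTE del0).
    have [[|k] [G1 [GE G1t]]] := poly_factor_root G0 Gt; rewrite -XE in GE.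
      move: dGt; rewrite GE dX expr0 mul1r.
      rewrite !(hornerD, hornerM, hornerC) Xt mul0r add0r mul1r => /eqP.
      by rewrite (negbTE G1t).
    pose G2 := X * G1^`() + k.+2%:R%:P * G1.
    have dG : G^`() = X ^+ k.+1 * G2 by rewrite GE dX.
    pose G3 := X * G2^`() + k.+1%:R%:P * G2.
    have ddG : G^`()^`() = X ^+ k * G3 by rewrite dG dX.
    pose P2 := (del ^+ 2)%:P * X ^+ 2 * G1 ^+ 2 + (mu ^+ 2)%:P * (1 - 'X^2) * G2 ^+ 2.
    have PE2 : P = X ^+ (2 * k).+2 * P2.
      rewrite PE dG GE /P2 !exprS mulnC exprM; ring.
    have dP : P^`() = X ^+ (2 * k).+1 * (X * P2^`() + (2 * k).+2%:R%:P * P2).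
      by rewrite PE2 dX.
    have /cancel : X ^+ (3 * k).+2 * (P2 * ((mu ^+ 2)%:P * (1 - 'X^2) * G3
         + (beta%:P - nu%:P * 'X) * X * G2 + lam%:P * X ^+ 2 * G1)
       + (c * mu ^+ 2)%:P * (1 - 'X^2) * G2
         * (X * P2^`() + (2 * k).+2%:R%:P * P2)) = 0.
      rewrite -[RHS]ode ddG dP dG PE2 GE !exprS ![(_ * k)%N]mulnC !exprM; ring.
    have G2t : G2.[t] = k.+2%:R * G1.[t].
      by rewrite !(hornerD, hornerM, hornerC) Xt mul0r add0r.
    have G3t : G3.[t] = k.+1%:R * G2.[t].
      by rewrite !(hornerD, hornerM, hornerC) Xt mul0r add0r.
    have G2t0 : G2.[t] != 0 by rewrite G2t mulf_neq0 // pnatr_eq0.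
    have P2t : P2.[t] = mu ^+ 2 * (1 - t ^+ 2) * G2.[t] ^+ 2.
      rewrite /P2; clearbody G2.
      by rewrite !(hornerD, hornerN, hornerM, hornerC, hornerX, horner_exp) Xt; ring.
    have P2t0 : P2.[t] != 0 by rewrite P2t !mulf_neq0 ?expf_neq0.
    clearbody P2 G3 G2.
    rewrite !(hornerD, hornerN, hornerM, hornerC, hornerXn, hornerX, horner_exp) Xt G3t => H.
    have : P2.[t] * G2.[t] * mu ^+ 2 * (1 - t ^+ 2) * k.+1%:R * (1 + c * 2) = 0.
      have kE : (2 * k).+2 = (2 * k.+1)%N by rewrite mulnS.
      by rewrite -[RHS]H kE natrM; ring.
    by apply/eqP; rewrite !mulf_neq0 ?expf_neq0 // pnatr_eq0.
  (* The first term of the equation vanishes at least to the order of [P]; the term with P' vanishes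
     to exactly one order less, so it cannot be cancelled. *)
  + have [k [P1 [PE1 P1t]]] := poly_factor_root P0 (introT eqP Pt); rewrite -XE in PE1.
    have dP : P^`() = X ^+ k * (X * P1^`() + k.+1%:R%:P * P1).
      by rewrite PE1 dX.
    have /cancel : X ^+ k * (X * P1 * ((mu ^+ 2)%:P * (1 - 'X^2) * G^`()^`()
        + (beta%:P - nu%:P * 'X) * G^`() + lam%:P * G)
       + (c * mu ^+ 2)%:P * (1 - 'X^2) * G^`() * (X * P1^`() + k.+1%:R%:P * P1)) = 0.
      by rewrite -[RHS]ode dP PE1 [X ^+ k.+1]exprS; ring.
    rewrite !(hornerD, hornerN, hornerM, hornerC, hornerXn, hornerX) Xt.
    rewrite !mul0r !add0r; apply/eqP.
    by rewrite !mulf_neq0 ?expf_neq0 // pnatr_eq0.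
Qed.

(** The operator does not raise degrees, and Q'' and beta Q' fall below degree N; hence neither
    [beta] nor a lower coefficient of [Q] appears. *)
Lemma coef_sphere_lap (R : realFieldType) n m (beta : R) D (Q : {poly R}) N :
  size Q = N.+1 ->
  (sphere_lap n m beta D Q)`_N =
  (D%:R * (D%:R + n%:R - 2) - m%:R ^+ 2 * N%:R * (N%:R - 1)
   - m%:R * (m%:R + n%:R - 2) * N%:R) * lead_coef Q.
Proof.
move=> sQ; have cQ k : (N < k)%N -> Q`_k = 0.
  by move=> Nk; rewrite nth_default // sQ.
set nu := m%:R * (m%:R + n%:R - 2); set lam := D%:R * (D%:R + n%:R - 2).
have -> : sphere_lap n m beta D Q = (m%:R ^+ 2)%:P * Q^`()^`()
    - (m%:R ^+ 2)%:P * ('X^2 * Q^`()^`()) + beta%:P * Q^`() - nu%:P * ('X * Q^`()) + lam%:P * Q.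
  rewrite /sphere_lap -/nu -/lam; ring.
rewrite lead_coefE sQ /= !(coefD, coefN, coefCM, coefXnM, coefXM, coef_deriv).
rewrite (cQ N.+1) // (cQ N.+2) // !mul0rn.
by case: N sQ cQ => [|[|N]] _ _ /=; rewrite ?subn2 /=; ring.
Qed.

(** This is the p-Laplace equation on the sphere: u and |grad u|^2 have degrees d and 2(d - 1), and
    the product of their radial derivatives is the added term of order zero. *)
Lemma cone_ode_eq0 (R : rcfType) (p : R) n m m1 m2 d (G : {poly R}) :
  1 < p -> p != 2 -> (0 < m)%N -> (0 < m1)%N -> (m1 <= m2)%N ->
  (2 * n = (m1 + m2) * m + 4)%N -> (2 <= d)%N ->
  let c := (p - 2) / 2 in
  let beta := (m2%:R - m1%:R) / 2 * m%:R ^+ 2 in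
  let P := (d%:R ^+ 2)%:P * G ^+ 2 + (m%:R ^+ 2)%:P * (1 - 'X^2) * G^`() ^+ 2 in
  P * (sphere_lap n m beta d G + (c * d%:R * (2 * (d%:R - 1)))%:P * G)
    + (c * m%:R ^+ 2)%:P * (1 - 'X^2) * G^`() * P^`() = 0 -> G = 0.
Proof.
move=> p1 p2 m0 m10 m12 dim d2 c beta P ode; apply/eqP; apply: contraT => G0.
have nE : n%:R = (m1%:R + m2%:R) * m%:R / 2 + 2 :> R.
  have /(congr1 (fun k => k%:R : R)) := dim.
  rewrite natrD !natrM natrD => h; apply: (mulfI (x := 2)); first by rewrite pnatr_eq0.
  by rewrite h; field.
have mR : 0 < m%:R :> R by rewrite ltr0n.
have m1R : 0 < m1%:R :> R by rewrite ltr0n.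
have m2R : m1%:R <= m2%:R :> R by rewrite ler_nat.
have dR : 2 <= d%:R :> R by rewrite (ler_nat _ 2).
have dn0 : d%:R != 0 :> R by rewrite gt_eqF //; lra.
have c0 : c != 0 by rewrite mulf_neq0 ?subr_eq0 // invr_eq0 pnatr_eq0.
have cp : 1 + c * 2 = p - 1 by rewrite /c; field.
have betaE : beta = (m2%:R - m1%:R) / 2 * m%:R ^+ 2 by [].
have cE : c = (p - 2) / 2 by [].
have PE : P = (d%:R ^+ 2)%:P * G ^+ 2 + (m%:R ^+ 2)%:P * (1 - 'X^2) * G^`() ^+ 2 by [].
clearbody P c beta.
have P0 : P != 0.
  apply: contraNneq G0 => P0; apply/eqP.
  (* The points 1/(k+1) lie in [-1, 1], where both summands of [P] are nonnegative; P = 0 would make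
     [G] vanish at all of them. *)
  apply: (poly_eq0_seq (s := fun k => k.+1%:R^-1)) => [i j /invr_inj/eqP|k].
    by rewrite eqr_nat => /eqP[].
  have : P.[k.+1%:R^-1] = 0 by rewrite P0 horner0.
  rewrite PE !(horner_exp, hornerD, hornerN, hornerM, hornerC, hornerX) => /eqP.
  have k1 : (k.+1%:R^-1 : R) ^+ 2 <= 1.
    by rewrite exprn_ile1 ?invr_ge0 ?ler0n // invf_le1 ?ltr0n // ler1n.
  rewrite paddr_eq0; last 2 first.
  - by apply: mulr_ge0; apply: sqr_ge0.
  - by apply: mulr_ge0; [apply: mulr_ge0; rewrite ?sqr_ge0 ?subr_ge0 // | apply: sqr_ge0].
  move=> /andP[+ _].
  rewrite mulf_eq0 !expf_eq0 /= => /orP[|/eqP//].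
  by rewrite (negbTE dn0).
have sP : size P = 1%N.
  apply/eqP; rewrite -(size_map_poly (real_complex R)); apply: contraT => /closed_rootP[t].
  move/rootP/eqP; apply: contraTT => _.
  pose f : {rmorphism R -> R[i]} := real_complex R.
  pose mf : {rmorphism {poly R} -> {poly R[i]}} := map_poly f.
  have fn k : f k%:R = k%:R by rewrite rmorph_nat.
  have mfX : mf 'X = 'X by exact: map_polyX.
  have mfC a : mf a%:P = (f a)%:P by exact: map_polyC.
  have mfd q : mf q^`() = (mf q)^`() by symmetry; exact: deriv_map.
  pose mfE := (rmorphB mf, rmorphD mf, rmorphM mf, rmorphN mf, rmorphXn mf, rmorph1 mf, mfX, mfC, mfd).
  pose fE := (rmorphB f, rmorphD f, rmorphM f, rmorphN f, rmorphXn f, rmorph1 f, fn).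
  have f0 a : (f a == 0) = (a == 0) by rewrite fmorph_eq0.
  apply: (@cone_ode_no_root _ (f m%:R) (f d%:R) (f beta)
     (f (m%:R * (m%:R + n%:R - 2)))
     (f (d%:R * (d%:R + n%:R - 2) + c * d%:R * (2 * (d%:R - 1)))) (f c) t (mf G) (mf P)).
  - by rewrite f0 gt_eqF.
  - by rewrite f0.
  - by rewrite f0.
  - suff : f (1 + c * 2) != 0 by rewrite (rmorphD f) (rmorphM f) fn (rmorph1 f).
    by rewrite f0 cp subr_eq0 gt_eqF.
  - move=> k; suff : f ((2 * k + 1)%:R * (1 + c * 2) * m%:R ^+ 2
        + (m%:R * (m%:R + n%:R - 2) - m%:R ^+ 2 - beta)) != 0.
      by rewrite !(rmorphB f, rmorphD f, rmorphM f, rmorphXn f, rmorph1 f, fn).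
    rewrite f0 cp nE betaE gt_eqF //.
    (* The dimension relation gives m (n - 2) = (m1 + m2) m^2 / 2, so subtracting [beta] leaves m1
       m^2; adding it, for t = -1, leaves m2 m^2. *)
    have -> : (2 * k + 1)%:R * (p - 1) * m%:R ^+ 2
       + (m%:R * (m%:R + ((m1%:R + m2%:R) * m%:R / 2 + 2) - 2) - m%:R ^+ 2
       - (m2%:R - m1%:R) / 2 * m%:R ^+ 2)
       = ((2 * k + 1)%:R * (p - 1) + m1%:R) * m%:R ^+ 2 :> R by field.
    by rewrite mulr_gt0 ?exprn_gt0 // addr_gt0 // mulr_gt0 ?subr_gt0 // ltr0n addn1.
  - move=> k; suff : f ((2 * k + 1)%:R * (1 + c * 2) * m%:R ^+ 2
        + (m%:R * (m%:R + n%:R - 2) - m%:R ^+ 2 + beta)) != 0.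
      by rewrite !(rmorphB f, rmorphD f, rmorphM f, rmorphXn f, rmorph1 f, fn).
    rewrite f0 cp nE betaE gt_eqF //.
    have -> : (2 * k + 1)%:R * (p - 1) * m%:R ^+ 2
       + (m%:R * (m%:R + ((m1%:R + m2%:R) * m%:R / 2 + 2) - 2) - m%:R ^+ 2
       + (m2%:R - m1%:R) / 2 * m%:R ^+ 2)
       = ((2 * k + 1)%:R * (p - 1) + m2%:R) * m%:R ^+ 2 :> R by field.
    apply: mulr_gt0; last exact: exprn_gt0.
    apply: addr_gt0; last exact: lt_le_trans m2R.
    by rewrite mulr_gt0 ?subr_gt0 // ltr0n addn1.
  - by rewrite PE !mfE !fE.
  - apply: etrans (rmorph0 mf); apply: etrans (congr1 mf ode).
    rewrite /sphere_lap !mfE !fE; ring.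
  - by rewrite map_poly_eq0.
have dP : P^`() = 0.
  by have /size_poly1P[a _ ->] : size P == 1%N by [apply/eqP]; rewrite derivC.
move: ode; rewrite dP mulr0 addr0 => /eqP; rewrite mulf_eq0 (negbTE P0) /= => /eqP L.
have [N sG] : exists N, size G = N.+1.
  by exists (size G).-1; rewrite prednK // lt0n size_poly_eq0.
have lc0 : lead_coef G != 0 by rewrite lead_coef_eq0.
have /(congr1 (fun q : {poly R} => q`_N)) := L.
rewrite coef0 coefD coefCM (coef_sphere_lap _ _ _ _ sG) -[G`_N]/(G`_N.+1.-1) -sG -lead_coefE.
rewrite -mulrDl => /eqP; rewrite mulf_eq0 (negbTE lc0) orbF => /eqP.
(* For constant [G] the identity P' = 0 carries no information; there the coefficient of order zero
   is positive. *)
case: N sG => [|N] sG.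
  rewrite !mulr0 mul0r !subr0 nE => h.
  have : d%:R * ((d%:R - 1) * (p - 1) + (m1%:R + m2%:R) * m%:R / 2 + 1) = 0 :> R.
    by rewrite -[RHS]h cE; field.
  suff : 0 < d%:R * ((d%:R - 1) * (p - 1) + (m1%:R + m2%:R) * m%:R / 2 + 1) :> R.
    by move=> /lt0r_neq0/eqP.
  rewrite mulr_gt0 //; first by lra.
  have h1 : 0 < (d%:R - 1) * (p - 1) by apply: mulr_gt0; lra.
  have h2 : 0 < (m1%:R + m2%:R) * m%:R :> R by apply: mulr_gt0; lra.
  lra.
(* P' is 2 G' times this expression, and G' can be cancelled. Its top coefficient gives d = m deg
   G. *)
have cheb : (d%:R ^+ 2)%:P * G + (m%:R ^+ 2)%:P * ((1 - 'X^2) * G^`()^`() - 'X * G^`()) = 0.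
  have dG : G^`() != 0.
    apply/eqP => /(congr1 (fun q : {poly R} => q`_N)).
    rewrite coef0 coef_deriv => /eqP; rewrite mulrn_eq0 /= -[N.+1]/(N.+2.-1) -sG.
    by rewrite -lead_coefE (negbTE lc0).
  apply: (mulfI (x := 2%:R%:P * G^`())); first by rewrite mulf_neq0 ?polyC_eq0 ?pnatr_eq0.
  rewrite mulr0 -[RHS]dP PE !(deriv_exp, derivD, derivN, derivM, derivC, derivX) /= polyC_natr; ring.
move=> H.
have {cheb} dN : d%:R ^+ 2 = m%:R ^+ 2 * N.+1%:R ^+ 2 :> R.
  have /(congr1 (fun q : {poly R} => q`_N.+1)) := cheb.
  rewrite coef0 mulrBl mul1r !(coefD, coefCM, coefN) coefXnM coefXM !coef_deriv /=.
  rewrite [G`_N.+3]nth_default ?sG // !mul0rn sub0r.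
  have -> : (if (N.+1 < 2)%N then 0 else G`_(N.+1 - 2).+2 *+ (N.+1 - 2).+2 *+ (N.+1 - 2).+1)
     = G`_N.+1 * N.+1%:R * N%:R.
    by case: (N) => [|M]; rewrite ?subn2 /=; ring.
  rewrite -[G`_N.+1]/(G`_N.+2.-1) -sG -lead_coefE -natr1 => h.
  apply: (mulfI lc0); apply/eqP; rewrite -subr_eq0; apply/eqP.
  by rewrite -[RHS]h; ring.
have {}dN : d%:R = m%:R * N.+1%:R :> R.
  apply/eqP; rewrite -(eqrXn2 (n := 2)) ?mulr_ge0 ?ler0n //.
  by rewrite dN exprMn.
(* For d = m deg G the leading coefficient of [sphere_lap] cancels and only the radial term is
   left. *)
have : c * d%:R * (2 * (d%:R - 1)) = 0.
  by rewrite -[RHS]H dN; ring.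
move/eqP; suff /negbTE-> : c * d%:R * (2 * (d%:R - 1)) != 0 by [].
have d1 : 2 * (d%:R - 1) != 0 :> R by rewrite gt_eqF //; lra.
exact: mulf_neq0 (mulf_neq0 c0 dn0) d1.
Qed.

(** * A plane on which [phi] is [Re (z ^+ m)] *)

Lemma coefM_low (K : nzRingType) k (p q : {poly K}) :
  (forall l, (l <= k)%N -> q`_l = 0) -> forall l, (l <= k)%N -> (p * q)`_l = 0.
Proof.
move=> q0 l lk; rewrite coefM big1 // => j _; rewrite q0 ?mulr0 //.
exact: leq_trans (leq_subr _ _) lk.
Qed.

(* The last hypothesis is what a linear system [kappa E' = M E] provides: only
orders of vanishing at 0 matter. *)
Lemma linear_ode_eq0 (K : numDomainType) (I : Type) (kappa : {poly K}) (E : I -> {poly K}) :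
  kappa.[0] != 0 -> (forall i, (E i).[0] = 0) ->
  (forall k, (forall j l, (l <= k)%N -> (E j)`_l = 0) ->
     forall i, (kappa * (E i)^`())`_k = 0) ->
  forall i, E i = 0.
Proof.
move=> kappa0 E0 ode.
have low k : forall j l, (l <= k)%N -> (E j)`_l = 0.
  elim: k => [|k IH] j l; first by rewrite leqn0 => /eqP->; rewrite -horner_coef0.
  rewrite leq_eqVlt ltnS => /orP[/eqP->|]; last exact: IH.
  have := ode k IH j; rewrite coefM big_ord_recl /= subn0 coef_deriv big1 ?addr0.
    move/eqP; rewrite mulf_eq0 -horner_coef0 (negbTE kappa0) /=.
    by rewrite mulrn_eq0 => /eqP.
  move=> i _; rewrite coef_deriv IH ?mul0rn ?mulr0 //.
  by rewrite /bump add1n subnSK ?leq_subr.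
by move=> i; apply/polyP => k; rewrite coef0 (low k).
Qed.

Section GreatCircle.
Variables (R : rcfType) (n m : nat) (phi : {mpoly R[n]}).
Hypotheses (m0 : (0 < m)%N) (phi_homog : phi \is m.-homog)
  (phi_grad : mgradprod phi phi = m%:R ^+ 2 *: rho ^+ m.-1).

(** Derivative of the identity for |grad phi|^2. The factor [rho] avoids the exponent m - 2,
    negative for m = 1. *)
Lemma hessian_gradient i :
  rho * (\sum_j mderiv j phi * mderiv j (mderiv i phi)) =
  (m.-1)%:R *: ('X_i * mgradprod phi phi).
Proof.
have /(congr1 (mderiv i)) := phi_grad.
have -> : mderiv i (mgradprod phi phi) =
    2%:R *: \sum_j mderiv j phi * mderiv j (mderiv i phi).
  rewrite raddf_sum scaler_sumr; apply: eq_bigr => j _ /=.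
  by rewrite mderivM mderiv_comm scaler_nat; ring.
move=> /(congr1 (fun q => rho * q)).
rewrite phi_grad -scalerAr mderivZ => h.
have two0 : 2%:R != 0 :> R by rewrite pnatr_eq0.
apply: (scalerI two0).
rewrite h; case: (m.-1) => [|k].
  by rewrite expr0 -mpolyC1 mderivC !scale0r !scaler0 mulr0.
have -> : mderiv i (rho ^+ k.+1) = (k.+1%:R * 2) *: (rho ^+ k * 'X_i)
    :> {mpoly R[n]}.
  elim: k {h} => [|k IH]; first by rewrite exprS expr0 mulr1 mderiv_rho !mul1r scaler_nat.
  by rewrite exprS mderivM IH mderiv_rho -!scalerA !scaler_nat exprS; ring.
by rewrite -!mul_mpolyC mpolyCM exprS; ring.
Qed.

Variables (x0 v : 'I_n -> R).
Hypotheses (x0_unit : \sum_i x0 i * x0 i = 1) (v_unit : \sum_i v i * v i = 1)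
  (x0v : \sum_i x0 i * v i = 0).

Local Notation lp := (line_mpoly x0 v).
(** Data along the line x0 + t v: gradient [N], Hessian [H], the components [A] and [B] of the
    gradient along [x0] and [v], the moving point [L], and |grad phi|^2 as [W]. An affine line keeps
    everything polynomial; homogeneity later recovers the plane. *)
Let N i := lp (mderiv i phi).
Let H i j := lp (mderiv j (mderiv i phi)).
Let A := \sum_j (x0 j)%:P * N j.
Let B := \sum_j (v j)%:P * N j.
Let L i := (x0 i)%:P + (v i)%:P * 'X.
Let W := \sum_j N j * N j.

Lemma line_L i : lp 'X_i = L i.
Proof. by rewrite line_mpolyX -mul_polyC. Qed.

Lemma line_rho : lp rho = 1 + 'X^2.
Proof.
rewrite /rho raddf_sum /=; under eq_bigr do rewrite rmorphM /= line_L.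
transitivity ((\sum_i x0 i * x0 i)%:P + (\sum_i x0 i * v i)%:P * 'X *+ 2
   + (\sum_i v i * v i)%:P * 'X^2); last first.
  by rewrite x0_unit v_unit x0v mul1r mul0r mul0rn addr0.
rewrite !raddf_sum /= !mulr_suml -sumrMnl -!big_split; apply: eq_bigr => i _ /=.
rewrite /L !polyCM; ring.
Qed.

Lemma deriv_N i : (N i)^`() = \sum_j (v j)%:P * H i j.
Proof. by rewrite deriv_line_mpoly; apply: eq_bigr => j _; rewrite mul_polyC. Qed.

(** Euler's relation for the partial derivatives: the Hessian applied to [v] is the derivative along
    the line, which leaves its value on [x0]. *)
Lemma euler_N i : \sum_j (x0 j)%:P * H i j = (m.-1)%:R%:P * N i - 'X * (N i)^`().
Proof.
have /(congr1 lp) := euler_homog (dhomog_mderiv i phi_homog).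
rewrite -mul_mpolyC rmorphM /= line_mpolyC -/(N i) raddf_sum /= => <-.
rewrite deriv_N mulr_sumr -sumrB; apply: eq_bigr => j _.
rewrite rmorphM /= line_L /L -/(H i j); ring.
Qed.

Lemma hessian_N i : (1 + 'X^2) * (\sum_j N j * H i j) = (m.-1)%:R%:P * (L i * W).
Proof.
have /(congr1 lp) := hessian_gradient i.
rewrite -mul_mpolyC !rmorphM /= line_rho line_mpolyC line_L /mgradprod.
rewrite !(raddf_sum lp) /=.
under [X in _ * X]eq_bigr do rewrite rmorphM /=.
by under [X in _ = _ * (_ * X)]eq_bigr do rewrite rmorphM /=.
Qed.

Let E i := N i - (x0 i)%:P * A - (v i)%:P * B.

Lemma N_decomp i : N i = (x0 i)%:P * A + (v i)%:P * B + E i.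
Proof. by rewrite /E; ring. Qed.

(** Splitting the gradient along [x0], [v] and [E] expresses the Hessian applied to it through [N]
    and N'; only the normal part [E] still carries a Hessian. *)
Lemma line_system i :
  (1 + 'X^2) * ((m.-1)%:R%:P * A * N i + (B - 'X * A) * (N i)^`()
     + \sum_j E j * H i j) = (m.-1)%:R%:P * (L i * W).
Proof.
rewrite -hessian_N; congr (_ * _).
transitivity (A * (\sum_j (x0 j)%:P * H i j) + B * (\sum_j (v j)%:P * H i j)
   + \sum_j E j * H i j); first by rewrite euler_N -deriv_N; ring.
rewrite !mulr_sumr -!big_split; apply: eq_bigr => j _ /=; rewrite [in RHS]N_decomp; ring.
Qed.

Lemma contract_x0L : \sum_i (x0 i)%:P * L i = 1.
Proof.
transitivity ((\sum_i x0 i * x0 i)%:P + (\sum_i x0 i * v i)%:P * 'X).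
  rewrite !raddf_sum /= mulr_suml -big_split; apply: eq_bigr => i _ /=.
  rewrite /L !polyCM; ring.
by rewrite x0_unit x0v mul0r addr0.
Qed.

Lemma contract_vL : \sum_i (v i)%:P * L i = 'X.
Proof.
transitivity ((\sum_i x0 i * v i)%:P + (\sum_i v i * v i)%:P * 'X).
  rewrite !raddf_sum /= mulr_suml -big_split; apply: eq_bigr => i _ /=.
  rewrite /L !polyCM; ring.
by rewrite v_unit x0v mul1r add0r.
Qed.

Lemma deriv_A : A^`() = \sum_j (x0 j)%:P * (N j)^`().
Proof. by rewrite raddf_sum; apply: eq_bigr => j _ /=; rewrite derivM derivC mul0r add0r. Qed.
Lemma deriv_B : B^`() = \sum_j (v j)%:P * (N j)^`().
Proof. by rewrite raddf_sum; apply: eq_bigr => j _ /=; rewrite derivM derivC mul0r add0r. Qed.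

Lemma contract_system (w : 'I_n -> R) :
  (1 + 'X^2) * ((m.-1)%:R%:P * A * (\sum_i (w i)%:P * N i)
     + (B - 'X * A) * (\sum_i (w i)%:P * (N i)^`())
     + \sum_i (w i)%:P * (\sum_j E j * H i j))
  = (m.-1)%:R%:P * ((\sum_i (w i)%:P * L i) * W).
Proof.
transitivity (\sum_i (w i)%:P * ((m.-1)%:R%:P * (L i * W))).
  under [RHS]eq_bigr do rewrite -line_system.
  rewrite !mulr_sumr -!big_split mulr_sumr /=; apply: eq_bigr => i _.
  ring.
by rewrite mulr_suml mulr_sumr; apply: eq_bigr => i _; ring.
Qed.

(* [E] is the component of [grad phi] normal to the plane of [x0] and [v].
Differentiating [|grad phi|^2 = m^2 r^(2m-2)] gives a linear system for [E]. *)
Lemma transverse_eq0 : (forall i, (E i).[0] = 0) -> B.[0] != 0 -> forall i, E i = 0.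
Proof.
move=> E0 B0; apply: (@linear_ode_eq0 _ _ ((1 + 'X^2) * (B - 'X * A))) => //.
  have -> (a b : {poly R}) : ((1 + 'X^2) * (b - 'X * a)).[0] = b.[0] by rewrite !hornerE; ring.
  exact: B0.
move=> k low i.
pose HE i := \sum_j E j * H i j.
have lowHE j l : (l <= k)%N -> (HE j)`_l = 0.
  move=> lk; rewrite coef_sum big1 // => a _.
  by rewrite mulrC (coefM_low (k := k)) // => b bk; apply: low.
pose T := (m.-1)%:R%:P * A * E i + HE i - (x0 i)%:P * (\sum_j (x0 j)%:P * HE j)
  - (v i)%:P * (\sum_j (v j)%:P * HE j).
have -> : (1 + 'X^2) * (B - 'X * A) * (E i)^`() = - ((1 + 'X^2) * T).
  apply/eqP; rewrite -subr_eq0 opprK; apply/eqP.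
  have dE : (E i)^`() = (N i)^`() - (x0 i)%:P * A^`() - (v i)%:P * B^`().
    by rewrite /E !(derivB, derivM, derivC) !mul0r !add0r.
  (* Subtracting the projections on [x0] and [v] removes the inhomogeneous term, because the point
     [L] lies in their plane. *)
  transitivity ((m.-1)%:R%:P * (L i * W)
     - (x0 i)%:P * ((m.-1)%:R%:P * ((\sum_i (x0 i)%:P * L i) * W))
     - (v i)%:P * ((m.-1)%:R%:P * ((\sum_i (v i)%:P * L i) * W))); last first.
    by rewrite contract_x0L contract_vL /L; ring.
  rewrite -line_system -!contract_system -/A -/B -deriv_A -deriv_B dE /T /E /HE; ring.
have lowS (w : 'I_n -> R) l : (l <= k)%N -> (\sum_j (w j)%:P * HE j)`_l = 0.
  move=> lk; rewrite coef_sum big1 // => j _.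
  by rewrite (coefM_low (k := k)) // => b; apply: lowHE.
have lowT l : (l <= k)%N -> T`_l = 0.
  move=> lk; rewrite /T !(coefD, coefN) lowHE // !(coefM_low (k := k)) ?oppr0 ?addr0 //.
  - by move=> b; apply: lowS.
  - by move=> b; apply: lowS.
  - by move=> b; apply: low.
by rewrite coefN (coefM_low (k := k)) ?oppr0.
Qed.

Lemma line_phi : m%:R%:P * lp phi = A + 'X * B.
Proof.
have /(congr1 lp) := euler_homog phi_homog.
rewrite -mul_mpolyC rmorphM /= line_mpolyC raddf_sum /= => <-.
rewrite mulr_sumr -big_split; apply: eq_bigr => j _ /=.
rewrite rmorphM /= line_L /L -/(N j); ring.
Qed.

Hypotheses (E0 : forall i, (E i).[0] = 0) (B0 : B.[0] != 0).

Lemma line_W : W = A ^+ 2 + B ^+ 2.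
Proof.
have norm2 (a b : {poly R}) :
    \sum_i ((x0 i)%:P * a + (v i)%:P * b) ^+ 2 = a ^+ 2 + b ^+ 2.
  transitivity ((\sum_i x0 i * x0 i)%:P * a ^+ 2 + (\sum_i x0 i * v i)%:P * (a * b) *+ 2
     + (\sum_i v i * v i)%:P * b ^+ 2); last first.
    by rewrite x0_unit v_unit x0v !mul1r mul0r mul0rn addr0.
  rewrite !raddf_sum /= !mulr_suml -sumrMnl -!big_split; apply: eq_bigr => i _ /=.
  rewrite !polyCM; ring.
rewrite -[RHS]norm2; apply: eq_bigr => i _.
by rewrite {1 2}[N i]N_decomp (transverse_eq0 E0 B0) addr0 expr2.
Qed.

(** Once [E] is zero and W = A^2 + B^2, both projections of [line_system] are divisible by B - t A,
    the coefficient of the derivative. *)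
Lemma line_ode :
  (1 + 'X^2) * B^`() = (m.-1)%:R%:P * ('X * B - A) /\
  (1 + 'X^2) * A^`() = (m.-1)%:R%:P * (B + 'X * A).
Proof.
have HE0 (w : 'I_n -> R) : \sum_i (w i)%:P * (\sum_j E j * H i j) = 0.
  rewrite big1 // => i _; rewrite big1 ?mulr0 // => j _.
  by rewrite transverse_eq0 // mul0r.
have K0 : B - 'X * A != 0.
  apply: contraNneq B0 => /(congr1 (fun q : {poly R} => q.[0])).
  have -> (a b : {poly R}) : (b - 'X * a).[0] = b.[0] by rewrite !hornerE; ring.
  by rewrite horner0 => ->.
have := contract_system v; have := contract_system x0.
rewrite !HE0 -/A -/B -deriv_A -deriv_B contract_x0L contract_vL line_W !addr0 => hA hB.
split; apply: (mulfI K0).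
- transitivity ((m.-1)%:R%:P * ('X * (A ^+ 2 + B ^+ 2)) - (1 + 'X^2) * ((m.-1)%:R%:P * A * B)).
    by rewrite -hB; ring.
  ring.
- transitivity ((m.-1)%:R%:P * (1 * (A ^+ 2 + B ^+ 2)) - (1 + 'X^2) * ((m.-1)%:R%:P * A * A)).
    by rewrite -hA; ring.
  ring.
Qed.

End GreatCircle.

Local Notation "z ^J" := (conjc z) (at level 2, left associativity, format "z ^J").
Lemma sphere_tangent_norm (R : realFieldType) n m (phi : {mpoly R[n]}) x :
  phi \is m.-homog -> mgradprod phi phi = m%:R ^+ 2 *: rho ^+ m.-1 -> rho.@[x] = 1 ->
  \sum_i ((mderiv i phi).@[x] - m%:R * phi.@[x] * x i) ^+ 2 =
  m%:R ^+ 2 * (1 - phi.@[x] ^+ 2).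
Proof.
move=> hom hgrad x1.
have h1 : \sum_i x i * (mderiv i phi).@[x] = m%:R * phi.@[x].
  have /(congr1 (meval x)) := euler_homog hom.
  rewrite mevalZ raddf_sum /= => <-; apply: eq_bigr => i _.
  by rewrite mevalM mevalXU.
have h2 : \sum_i (mderiv i phi).@[x] * (mderiv i phi).@[x] = m%:R ^+ 2.
  have /(congr1 (meval x)) := hgrad.
  rewrite mevalZ rmorphXn /= x1 expr1n mulr1 raddf_sum /= => <-.
  by apply: eq_bigr => i _; rewrite mevalM.
rewrite meval_rho in x1.
under eq_bigr do rewrite -[(mderiv _ phi).@[x]]mul1r addrC -mulNr expr2.
by rewrite sum_lincomb2 x1 h1 h2; ring.
Qed.

Lemma isoparametric_le1 (R : realFieldType) n m (phi : {mpoly R[n]}) x :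
  (0 < m)%N -> phi \is m.-homog -> mgradprod phi phi = m%:R ^+ 2 *: rho ^+ m.-1 ->
  rho.@[x] = 1 -> phi.@[x] ^+ 2 <= 1.
Proof.
move=> m0 hom hgrad x1; rewrite -subr_ge0 -(pmulr_rge0 _ (x := m%:R ^+ 2)).
  by rewrite -(sphere_tangent_norm hom hgrad x1) sumr_ge0 // => i _; apply: sqr_ge0.
by rewrite exprn_gt0 // ltr0n.
Qed.

Section Circle.
Variables (R : rcfType) (n m : nat) (phi : {mpoly R[n]}) (x0 : 'I_n -> R).
Hypotheses (m0 : (0 < m)%N) (hom : phi \is m.-homog)
  (hgrad : mgradprod phi phi = m%:R ^+ 2 *: rho ^+ m.-1)
  (x0_unit : rho.@[x0] = 1) (x0_regular : phi.@[x0] ^+ 2 != 1).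

Local Open Scope complex_scope.
Let f : {rmorphism R -> R[i]} := real_complex R.
Let iC : R[i] := 0 +i* 1.

Lemma iC2 : iC * iC = -1.
Proof. by apply/eqP; rewrite eq_complex /= !mul0r !mulr0 !mulr1 sub0r !addr0 oppr0 !eqxx. Qed.

Lemma Re_realM (a : R) z : complex.Re (f a * z) = a * complex.Re z.
Proof. by case: z => b c /=; rewrite mul0r subr0. Qed.

Let t := phi.@[x0].
Let s := Num.sqrt (1 - t ^+ 2).
(** The normalized spherical gradient at [x0]: by [sphere_tangent_norm] its length before scaling is
    m s, and s <> 0 at a regular point. With this choice the normal component of the gradient starts
    at 0. *)
Let v i := ((mderiv i phi).@[x0] - m%:R * t * x0 i) / (m%:R * s).

Lemma s2 : s ^+ 2 = 1 - t ^+ 2.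
Proof. by rewrite sqr_sqrtr // subr_ge0 (isoparametric_le1 m0 hom hgrad). Qed.

Lemma s_neq0 : s != 0.
Proof.
apply: contraNneq x0_regular => s0; rewrite -subr_eq0 -oppr_eq0 opprB.
by rewrite -[phi.@[x0]]/t -s2 s0 expr0n.
Qed.

Lemma m_neq0 : m%:R != 0 :> R. Proof. by rewrite pnatr_eq0 -lt0n. Qed.
Lemma ms_neq0 : m%:R * s != 0. Proof. exact: mulf_neq0 m_neq0 s_neq0. Qed.

Lemma x0_dot : \sum_i x0 i * x0 i = 1.
Proof. by rewrite -[RHS]x0_unit meval_rho; apply: eq_bigr => i _; rewrite expr2. Qed.

Lemma x0_grad : \sum_i x0 i * (mderiv i phi).@[x0] = m%:R * t.
Proof.
have /(congr1 (meval x0)) := euler_homog hom.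
rewrite mevalZ raddf_sum /= => <-; apply: eq_bigr => i _.
by rewrite mevalM mevalXU.
Qed.

Lemma v_dot : \sum_i v i * v i = 1.
Proof.
have := sphere_tangent_norm hom hgrad x0_unit; rewrite -/t -s2 => h.
have -> : \sum_i v i * v i =
    (\sum_i ((mderiv i phi).@[x0] - m%:R * t * x0 i) ^+ 2) / (m%:R * s) ^+ 2.
  rewrite mulr_suml; apply: eq_bigr => i _; rewrite /v; field.
  by rewrite s_neq0 m_neq0.
by rewrite h -exprMn divff // expf_neq0 // ms_neq0.
Qed.

Lemma x0_dot_v : \sum_i x0 i * v i = 0.
Proof.
transitivity ((\sum_i x0 i * (mderiv i phi).@[x0] - m%:R * t * \sum_i x0 i * x0 i)
   / (m%:R * s)); last by rewrite x0_grad x0_dot mulr1 subrr mul0r.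
rewrite mulr_sumr -sumrB mulr_suml; apply: eq_bigr => i _; rewrite /v; ring.
Qed.

Lemma grad_decomp i : (mderiv i phi).@[x0] = m%:R * t * x0 i + m%:R * s * v i.
Proof. by rewrite /v [m%:R * s * _]mulrC divfK ?ms_neq0 // addrC subrK. Qed.

Lemma v_grad : \sum_i v i * (mderiv i phi).@[x0] = m%:R * s.
Proof.
transitivity (m%:R * s * (\sum_i v i * v i) + m%:R * t * (\sum_i x0 i * v i)).
  rewrite [m%:R * s * _]mulr_sumr [m%:R * t * _]mulr_sumr -big_split.
  apply: eq_bigr => i _ /=.
  rewrite grad_decomp.
  move: (v i) => w; ring.
by rewrite v_dot x0_dot_v mulr1 mulr0 addr0.
Qed.

Let N i := line_mpoly x0 v (mderiv i phi).
Let A := \sum_j (x0 j)%:P * N j.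
Let B := \sum_j (v j)%:P * N j.

Lemma N_at0 i : (N i).[0] = (mderiv i phi).@[x0].
Proof. by rewrite horner_line_mpoly; apply: meval_eq => j; rewrite mulr0 addr0. Qed.

Lemma A_at0 : A.[0] = m%:R * t.
Proof.
rewrite -x0_grad horner_sum; apply: eq_bigr => j _.
by rewrite hornerM hornerC N_at0.
Qed.

Lemma B_at0 : B.[0] = m%:R * s.
Proof.
rewrite -v_grad horner_sum; apply: eq_bigr => j _.
by rewrite hornerM hornerC N_at0.
Qed.

(** [m * zeta] is the value of A - iB at 0. *)
Let zeta : R[i] := t -i* s.

Lemma zetaE : zeta = f t - iC * f s.
Proof.
by rewrite [LHS]complexE /= rmorphN mulrN.
Qed.

(* [line_ode] says that [Z = A - iB] satisfies [(1 + X^2) Z' = (m - 1) (X + i) Z]. *)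
Lemma line_complex :
  map_poly f A - iC%:P * map_poly f B =
  (m%:R * zeta)%:P * (1 + iC%:P * 'X) ^+ m.-1.
Proof.
have E0 i : (N i - (x0 i)%:P * A - (v i)%:P * B).[0] = 0.
  have -> (a b c : {poly R}) y z :
      (a - y%:P * b - z%:P * c).[0] = a.[0] - y * b.[0] - z * c.[0] by rewrite !hornerE.
  rewrite N_at0 A_at0 B_at0 grad_decomp; ring.
have Bn0 : B.[0] != 0 by rewrite B_at0 ms_neq0.
have [hB hA] := line_ode hom hgrad x0_dot v_dot x0_dot_v E0 Bn0.
rewrite -/N -/A -/B in hA hB.
pose mf : {rmorphism {poly R} -> {poly R[i]}} := map_poly f.
have mfX : mf 'X = 'X by exact: map_polyX.
have mfC a : mf a%:P = (f a)%:P by exact: map_polyC.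
have mfd q : mf q^`() = (mf q)^`() by symmetry; exact: deriv_map.
have mf0 q : (mf q).[0] = f q.[0] by rewrite -(rmorph0 f); exact: horner_map.
have fn k : f k%:R = k%:R by rewrite rmorph_nat.
pose mfE := (rmorphB mf, rmorphD mf, rmorphM mf, rmorphXn mf, rmorph1 mf, mfX, mfC, mfd, fn).
have {}hA := congr1 mf hA; have {}hB := congr1 mf hB.
rewrite !mfE in hA hB.
change (mf A - iC%:P * mf B = (m%:R * zeta)%:P * (1 + iC%:P * 'X) ^+ m.-1).
have A0 := mf0 A; have B0' := mf0 B; rewrite A_at0 B_at0 in A0 B0'.
clear E0 Bn0 mfE mfd mf0; move: (mf A) (mf B) hA hB A0 B0' => a b ha hb a0 b0.
pose w := (1 + iC%:P * 'X) ^+ m.-1 : {poly R[i]}.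
have dw : (1 + iC%:P * 'X) * w^`() = (m.-1)%:R%:P * iC%:P * w.
  rewrite /w; case: (m.-1) => [|k]; first by rewrite expr0 derivC !mulr0 mul0r mul0r.
  rewrite deriv_exp !(derivD, derivM, derivC, derivX) /= polyC_natr exprS; ring.
have iC2P : iC%:P * iC%:P = -1 :> {poly R[i]} by rewrite -polyCM iC2 polyCN.
have dw2 : (1 + 'X^2) * w^`() = (m.-1)%:R%:P * ('X + iC%:P) * w.
  have -> : 1 + 'X^2 = (1 - iC%:P * 'X) * (1 + iC%:P * 'X) :> {poly R[i]}.
    transitivity (1 - (iC%:P * iC%:P) * 'X^2 : {poly R[i]}); last by ring.
    by rewrite iC2P; ring.
  rewrite -[LHS]mulrA dw.
  transitivity ((m.-1)%:R%:P * (iC%:P - (iC%:P * iC%:P) * 'X) * w); first by ring.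
  by rewrite iC2P; ring.
apply/eqP; rewrite -subr_eq0; apply/eqP.
apply: (@linear_ode_eq0 _ unit (1 + 'X^2)
  (fun=> a - iC%:P * b - (m%:R * zeta)%:P * w) _ _ _ tt).
- have -> : (1 + 'X^2).[0] = 1 :> R[i] by rewrite !hornerE; ring.
  exact: oner_neq0.
- move=> _; have w0 : w.[0] = 1 by rewrite /w horner_exp !hornerE expr1n.
  rewrite !(hornerD, hornerN, hornerM, hornerC) a0 b0 w0 mulr1 zetaE !rmorphM /= fn; ring.
- move=> k low _.
  have -> : (1 + 'X^2) * (a - iC%:P * b - (m%:R * zeta)%:P * w)^`()
     = (m.-1)%:R%:P * ('X + iC%:P) * (a - iC%:P * b - (m%:R * zeta)%:P * w).
    rewrite !(derivD, derivN, derivM, derivC) !mul0r !add0r.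
    transitivity ((1 + 'X^2) * a^`() - iC%:P * ((1 + 'X^2) * b^`())
      - (m%:R * zeta)%:P * ((1 + 'X^2) * w^`())); first by ring.
    rewrite ha hb dw2.
    transitivity ((m.-1)%:R%:P * (b + 'X * a - iC%:P * 'X * b + iC%:P * a)
       - (m%:R * zeta)%:P * ((m.-1)%:R%:P * ('X + iC%:P) * w)); first by ring.
    transitivity ((m.-1)%:R%:P * (- (iC%:P * iC%:P) * b + 'X * a - iC%:P * 'X * b + iC%:P * a)
       - (m%:R * zeta)%:P * ((m.-1)%:R%:P * ('X + iC%:P) * w)); last by ring.
    by rewrite iC2P; ring.
  by rewrite (coefM_low (k := k)) // => l; apply: low.
Qed.

(** By Euler, m phi = A + yB, the real part of (A - iB)(1 + iy); the extra factor raises the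
    exponent from m - 1 to m. *)
Lemma phi_line y :
  phi.@[fun i => x0 i + v i * y] = complex.Re (zeta * (1 + iC * f y) ^+ m).
Proof.
apply: (mulfI m_neq0).
have -> : m%:R * phi.@[fun i => x0 i + v i * y] = A.[y] + y * B.[y].
  have /(congr1 (fun q : {poly R} => q.[y])) := @line_phi _ _ _ _ hom x0 v.
  by rewrite !hornerM hornerD hornerM hornerC hornerX horner_line_mpoly => ->.
have /(congr1 (fun q : {poly R[i]} => q.[f y])) := line_complex.
rewrite !(hornerD, hornerN, hornerM, hornerC, hornerX, horner_exp) !horner_map => h.
have zm (z : R[i]) : z ^+ m = z ^+ m.-1 * z by rewrite -exprSr prednK.
rewrite -Re_realM rmorph_nat zm !mulrA -h.
transitivity (complex.Re (f (A.[y] + y * B.[y]) + iC * f (y * A.[y] - B.[y]))).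
  by rewrite /= !(mul0r, mulr0, subr0, addr0).
congr (complex.Re _); rewrite !(rmorphD, rmorphM, rmorphB) /=.
transitivity (f A.[y] - (iC * iC) * f y * f B.[y] + iC * (f y * f A.[y] - f B.[y])).
  by rewrite iC2; ring.
ring.
Qed.

Lemma phi_plane_neq0 a b : a != 0 ->
  phi.@[fun i => a * x0 i + b * v i] = complex.Re (zeta * (a +i* b) ^+ m).
Proof.
move=> a0; have -> : phi.@[fun i => a * x0 i + b * v i] =
    a ^+ m * phi.@[fun i => x0 i + v i * (b / a)].
  rewrite -(meval_homog _ _ hom); apply: meval_eq => i.
  by field.
rewrite phi_line -Re_realM rmorphXn /= mulrCA -exprMn; congr (complex.Re (_ * _ ^+ _)).
apply/eqP; rewrite eq_complex /=; apply/andP; split; apply/eqP; field; exact: a0.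
Qed.

(** The remaining case a = 0 follows because both sides are polynomials in [a], the real part being
    half the sum of a number and its conjugate. *)
Lemma phi_plane a b :
  phi.@[fun i => a * x0 i + b * v i] = complex.Re (zeta * (a +i* b) ^+ m).
Proof.
pose p := line_mpoly (fun i => b * v i) x0 phi.
have pE c : p.[c] = phi.@[fun i => c * x0 i + b * v i].
  by rewrite horner_line_mpoly; apply: meval_eq => i; rewrite addrC mulrC.
pose q := 2%:R *: map_poly f p - (zeta *: ('X + (iC * f b)%:P) ^+ m
   + zeta^J *: ('X - (iC * f b)%:P) ^+ m).
have qE c : q.[f c] = 2%:R * (f p.[c] - f (complex.Re (zeta * (c +i* b) ^+ m))).
  rewrite /q !(hornerD, hornerN, hornerZ, horner_exp, hornerX, hornerC) horner_map.
  rewrite mulrBr -addcJ; congr (_ - _).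
  have cE : f c + iC * f b = c +i* b by rewrite [RHS]complexE.
  have cjE : f c - iC * f b = (c +i* b)^J by rewrite [RHS]complexE /= rmorphN mulrN.
  by rewrite cE cjE !rmorphM rmorphXn.
have q0 : q = 0.
  apply: poly_eq0_nat => k; rewrite -(rmorph_nat f) qE pE phi_plane_neq0 ?pnatr_eq0 //.
  by rewrite subrr mulr0.
have /eqP := qE a; rewrite q0 horner0 eq_sym mulf_eq0 pnatr_eq0 /= subr_eq0 pE.
by rewrite (inj_eq (@complexI R)) => /eqP.
Qed.

Lemma exists_isoparametric_circle : exists kappa : 'I_n -> R[i], forall xi : R[i],
  f (rho.@[fun i => complex.Re (xi * kappa i)]) = xi * xi^J /\
  phi.@[fun i => complex.Re (xi * kappa i)] = complex.Re (xi ^+ m).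
Proof.
have zeta1 : zeta * zeta^J = 1.
  apply/eqP; rewrite eq_complex /=; apply/andP; split; apply/eqP; last by ring.
  transitivity (t ^+ 2 + s ^+ 2); first by ring.
  by rewrite s2; ring.
have zeta0 : zeta != 0.
  by apply: contra_eq_neq zeta1 => ->; rewrite mul0r eq_sym oner_eq0.
pose xi0 : R[i] := m.-root zeta^-1.
have xi0m : xi0 ^+ m = zeta^-1 by rewrite rootCK.
have xi01 : xi0 * xi0^J = 1.
  apply/eqP; rewrite -(pexpr_eq1 (n := m)) ?mulcJ_ge0 //.
  have xic : xi0^J ^+ m = (xi0 ^+ m)^J by rewrite rmorphXn.
  by rewrite exprMn xic xi0m conjc_inv -invfM zeta1 invr1.
(* Re((a + ib)(x0 - iv)) = a x0 + b v parametrizes the plane; rotating by [xi0], an m-th root of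
   1/zeta, absorbs the phase [zeta]. *)
exists (fun i => xi0 * (x0 i -i* v i)) => xi.
have ReE i : complex.Re (xi * (xi0 * (x0 i -i* v i))) =
    complex.Re (xi * xi0) * x0 i + complex.Im (xi * xi0) * v i.
  by rewrite mulrA; case: (xi * xi0) => a b /=; ring.
split.
  transitivity (xi * xi0 * (xi * xi0)^J); last first.
    by rewrite rmorphM /= mulrACA xi01 mulr1.
  under meval_eq do rewrite ReE.
  rewrite meval_rho; case: (xi * xi0) => a b /=.
  under eq_bigr do rewrite expr2.
  rewrite sum_lincomb2 x0_dot_v v_dot; under eq_bigr do rewrite expr2.
  rewrite x0_dot; apply/eqP; rewrite eq_complex /=; apply/andP; split; apply/eqP; ring.
under meval_eq do rewrite ReE.
rewrite phi_plane; congr (complex.Re _).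
have -> : complex.Re (xi * xi0) +i* complex.Im (xi * xi0) = xi * xi0 by case: (xi * xi0).
by rewrite exprMn xi0m mulrCA divff // mulr1.
Qed.

End Circle.


(** * Polynomials constant on the level sets of [phi] *)

Lemma closed_prim_root_exists (C : numClosedFieldType) n :
  (0 < n)%N -> exists z : C, n.-primitive_root z.
Proof.
move=> n0; have [r Dp] := closed_field_poly_normal ('X^n - 1 : {poly C}).
rewrite (monicP _) ?monicXnsubC // scale1r in Dp.
have rn1 : all n.-unity_root r by apply/allP => z; rewrite -root_prod_XsubC -Dp.
have sz_r : (n < (size r).+1)%N by rewrite -(size_prod_XsubC r id) -Dp size_XnsubC.
have [|z] := hasP (has_prim_root n0 rn1 _ sz_r); last by exists z.
by rewrite -separable_prod_XsubC -Dp separable_Xn_sub_1 // pnatr_eq0 -lt0n.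
Qed.

Lemma horner_mmap n (K : nzRingType) (S : comNzRingType) (g : {rmorphism K -> {poly S}})
    (h : 'I_n -> {poly S}) (p : {mpoly K[n]}) z :
  (mmap g h p).[z] = mmap (fun a => (g a).[z]) (fun i => (h i).[z]) p.
Proof.
rewrite /mmap horner_sum; apply: eq_bigr => m _; rewrite hornerM; congr (_ * _).
by rewrite /mmap1 horner_prod; apply: eq_bigr => i _; rewrite horner_exp.
Qed.

Lemma size_mmap_affine n D (K : nzRingType) (S : comNzRingType) (g : K -> {poly S})
    (h : 'I_n -> {poly S}) (p : {mpoly K[n]}) :
  (forall a, (size (g a) <= 1)%N) -> (forall i, (size (h i) <= 2)%N) ->
  p \is D.-homog -> (size (mmap g h p) <= D.+1)%N.
Proof.
move=> sg sh /dhomogP hom; rewrite /mmap big_seq.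
elim/big_ind: _ => [|q r hq hr|mm /hom <- /=]; first by rewrite size_poly0.
  by apply: leq_trans (size_polyD _ _) _; rewrite geq_max hq.
apply: leq_trans (size_polyMleq _ _) _.
have : (size (mmap1 h mm) <= (mdeg mm).+1)%N.
  rewrite mdegE.
  apply: (big_ind2 (fun (q : {poly S}) k => (size q <= k.+1)%N)).
  - by rewrite size_poly1.
  - move=> q a r b hq hr; apply: leq_trans (size_polyMleq _ _) _; lia.
  - move=> i _; apply: leq_trans (size_poly_exp_leq _ _) _.
    by have := sh i; case: (size (h i)) => [|[|[|k]]] //= _; lia.
by have := sg p@_mm; move: (size _) (size _) (mdeg _) => a b c; lia.
Qed.

Section LevelSets.
Variables (R : rcfType) (n m : nat) (phi : {mpoly R[n]}) (beta : R).
Hypotheses (m0 : (0 < m)%N) (phiP : isoparametric m phi beta).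
Local Open Scope complex_scope.
Let f : {rmorphism R -> R[i]} := real_complex R.

Lemma Re_unit_rec (z : R[i]) k : z * z^J = 1 ->
  complex.Re (z ^+ k.+2) =
  2 * complex.Re z * complex.Re (z ^+ k.+1) - complex.Re (z ^+ k).
Proof.
move=> z1; rewrite !exprS; case: z z1 => a b /eqP.
rewrite eq_complex /= => /andP[/eqP h _].
case: ((a +i* b) ^+ k) => c d /=.
have {}h : a ^+ 2 + b ^+ 2 = 1 by rewrite -h; ring.
transitivity (2 * a * (a * c - b * d) - (a ^+ 2 + b ^+ 2) * c); first by ring.
by rewrite h; ring.
Qed.

(** [T] is the Chebyshev polynomial of index [l] and [tau] is r^(lm) T(phi / r^m). In the three-term
    recurrence the factor [rho ^+ m] equalizes the degrees. *)
Lemma chebyshev_rep l : exists tau T, sphere_rep m phi beta (l * m) tau T /\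
  forall z : R[i], z * z^J = 1 -> complex.Re (z ^+ l) = T.[complex.Re z].
Proof.
suff [] : (exists tau T, sphere_rep m phi beta (l * m) tau T /\
    forall z : R[i], z * z^J = 1 -> complex.Re (z ^+ l) = T.[complex.Re z]) /\
  (exists tau T, sphere_rep m phi beta (l.+1 * m) tau T /\
    forall z : R[i], z * z^J = 1 -> complex.Re (z ^+ l.+1) = T.[complex.Re z]) by [].
elim: l => [|l [[tau0 [T0 [h0 e0]]] [tau1 [T1 [h1 e1]]]]].
  split; [exists 1, 1|exists phi, 'X]; split.
  - exact: srep1.
  - by move=> z _; rewrite expr0 hornerC.
  - by rewrite mul1n; apply: srep_phi.
  - by move=> z _; rewrite expr1 hornerX.
split; first by exists tau1, T1.
exists (2 *: (phi * tau1) + (-1) *: (rho ^+ m * tau0)),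
  (2 *: ('X * T1) + (-1) *: (1 ^+ m * T0)); split.
  apply: srepD; apply: srepZ.
    by rewrite mulSn; apply: srepM h1 => //; apply: srep_phi.
  have -> : (l.+2 * m = m * 2 + l * m)%N by rewrite !mulSn addnA addnn -muln2.
  by apply: srepM h0 => //; apply: srepX => //; apply: srep_rho.
move=> z z1; rewrite Re_unit_rec // e0 // e1 // expr1n mul1r.
by rewrite hornerD !hornerZ hornerM hornerX; ring.
Qed.

Variable kappa : 'I_n -> R[i].
Hypothesis circle : forall xi : R[i],
  f (rho.@[fun i => complex.Re (xi * kappa i)]) = xi * xi^J /\
  phi.@[fun i => complex.Re (xi * kappa i)] = complex.Re (xi ^+ m).

Let pt (xi : R[i]) i := complex.Re (xi * kappa i).

Lemma circle_unit (xi : R[i]) : xi * xi^J = 1 -> rho.@[pt xi] = 1.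
Proof. by move=> h; apply: (@complexI R); case: (circle xi) => -> _; rewrite h. Qed.

Lemma circle_phi (xi : R[i]) : phi.@[pt xi] = complex.Re (xi ^+ m).
Proof. by case: (circle xi). Qed.

Lemma unit_root (z : R[i]) k : (0 < k)%N -> z * z^J = 1 ->
  exists xi : R[i], xi * xi^J = 1 /\ xi ^+ k = z.
Proof.
move=> k0 z1; exists (k.-root z); rewrite rootCK //; split=> //.
apply/eqP; rewrite -(pexpr_eq1 (n := k)) ?mulcJ_ge0 //; apply/eqP.
have xic : (k.-root z)^J ^+ k = (k.-root z ^+ k)^J by rewrite rmorphXn.
by rewrite exprMn xic rootCK.
Qed.

(** Re(xi^m) takes every value in [-1, 1] on the unit circle, so the circle meets each level set of
    [phi] on the sphere. *)
Lemma circle_level x : phi.@[x] ^+ 2 <= 1 ->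
  exists xi : R[i], xi * xi^J = 1 /\ phi.@[pt xi] = phi.@[x].
Proof.
move=> h; pose s := Num.sqrt (1 - phi.@[x] ^+ 2).
have s2 : s ^+ 2 = 1 - phi.@[x] ^+ 2 by rewrite sqr_sqrtr // subr_ge0.
have [|xi [xi1 xim]] := @unit_root (phi.@[x] +i* s) m m0.
  move: (phi.@[x]) s2 => t s2.
  apply/eqP; rewrite eq_complex /=; apply/andP; split; apply/eqP; last by ring.
  transitivity (t ^+ 2 + s ^+ 2); first by ring.
  by rewrite s2; ring.
by exists xi; split=> //; rewrite circle_phi xim.
Qed.

Lemma unit_poly_eq0 (p : {poly R[i]}) : (forall z : R[i], z * z^J = 1 -> p.[z] = 0) -> p = 0.
Proof.
move=> H; pose d k : R := 1 + k%:R ^+ 2.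
have d0 k : d k != 0 by rewrite gt_eqF // ltr_wpDr ?ltr01 // sqr_ge0.
(* The rational parametrization of the circle gives infinitely many distinct points. *)
pose s k : R[i] := ((1 - k%:R ^+ 2) / d k) +i* (2 * k%:R / d k).
apply: (@poly_eq0_seq _ s) => [i j|k].
  rewrite /s => -[h1 h2].
  have e k : (1 - k%:R ^+ 2) / d k = 2 / d k - 1.
    by have := d0 k; rewrite /d => dk0; field.
  move: h1; rewrite !e => /addIr h1.
  have : i%:R * (2 / d i) = j%:R * (2 / d i) by rewrite {2}h1 mulrCA mulrA h2; ring.
  have dn : 2 / d i != 0 by rewrite mulf_neq0 ?invr_eq0 ?d0 // pnatr_eq0.
  by move/(mulIf dn)/eqP; rewrite eqr_nat => /eqP.
apply: H; have := d0 k; rewrite /s /d => dk0.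
apply/eqP; rewrite eq_complex /=; apply/andP; split; apply/eqP; last by ring.
by field.
Qed.


(** Turns identities on the sphere into identities between profiles: [phi] takes all the values
    1/(k+1) there. *)
Lemma level_poly_eq0 (p : {poly R}) :
  (forall x, rho.@[x] = 1 -> p.[phi.@[x]] = 0) -> p = 0.
Proof.
move=> H; apply: (poly_eq0_seq (s := fun k => k.+1%:R^-1)) => [i j /invr_inj/eqP|k].
  by rewrite eqr_nat => /eqP[].
set t : R := k.+1%:R^-1; pose s := Num.sqrt (1 - t ^+ 2).
have s2 : s ^+ 2 = 1 - t ^+ 2.
  rewrite sqr_sqrtr // subr_ge0 exprn_ile1 ?invr_ge0 ?ler0n //.
  by rewrite invf_le1 ?ltr0n // ler1n.
have [|xi [xi1 xim]] := @unit_root (t +i* s) m m0.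
  apply/eqP; rewrite eq_complex /=; apply/andP; split; apply/eqP; last by ring.
  transitivity (t ^+ 2 + s ^+ 2); first by ring.
  by rewrite s2; ring.
have -> : t = phi.@[pt xi] by rewrite circle_phi xim.
by apply: H; apply: circle_unit.
Qed.

Variables (D : nat) (q : {mpoly R[n]}).
Hypotheses (q_homog : q \is D.-homog)
  (q_level : forall x y, rho.@[x] = 1 -> rho.@[y] = 1 ->
     phi.@[x] = phi.@[y] -> q.@[x] = q.@[y])
  (phi_le1 : forall x, rho.@[x] = 1 -> phi.@[x] ^+ 2 <= 1).

(* Chosen so that [xi^D q(pt xi) = H(xi^2)] for [|xi| = 1]. *)
Let H : {poly R[i]} := mmap (polyC \o f)
  (fun i => (kappa i / 2)%:P * 'X + ((kappa i)^J / 2)%:P) q.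

Lemma mmap_meval (x : 'I_n -> R) : mmap f (fun i => f (x i)) q = f q.@[x].
Proof.
rewrite /mmap [RHS]rmorph_sum; apply: eq_bigr => mm _.
rewrite rmorphM /=; congr (_ * _); rewrite /mmap1 [RHS]rmorph_prod.
by apply: eq_bigr => i _; rewrite rmorphXn.
Qed.

(** For |xi| = 1, xi Re(xi kappa) = (xi^2 kappa + conj kappa) / 2 is affine in xi^2; homogeneity
    distributes the D factors xi over the coordinates. *)
Lemma circle_poly (xi : R[i]) : xi * xi^J = 1 -> H.[xi ^+ 2] = xi ^+ D * f q.@[pt xi].
Proof.
move=> xi1; rewrite horner_mmap -mmap_meval -(mmap_homog _ _ _ q_homog).
rewrite /mmap; apply: eq_bigr => mm _; rewrite /= hornerC; congr (_ * _).
rewrite /mmap1; apply: eq_bigr => i _; congr (_ ^+ _).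
rewrite hornerD hornerM !hornerC hornerX.
have two0 : 2 != 0 :> R[i] by rewrite pnatr_eq0.
apply: (mulfI two0); rewrite [RHS]mulrCA -[2 * f _]addcJ rmorphM /=.
transitivity (xi ^+ 2 * kappa i + (xi * xi^J) * (kappa i)^J); last by ring.
by rewrite xi1; field.
Qed.

Lemma size_circle_poly : (size H <= D.+1)%N.
Proof.
apply: size_mmap_affine => // [a|i]; first exact: size_polyC_leq1.
apply: leq_trans (size_polyD _ _) _; rewrite geq_max; apply/andP; split.
  apply: leq_trans (size_polyMleq _ _) _; rewrite size_polyX.
  by have := size_polyC_leq1 (kappa i / 2); case: (size _) => [|[|]].
exact: leq_trans (size_polyC_leq1 _) _.
Qed.

(** Conjugating xi preserves Re(xi^m), hence [q]; so [H] and its reversed polynomial agree on the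
    unit circle. *)
Lemma circle_poly_sym j : (j <= D)%N -> H`_(D - j) = H`_j.
Proof.
move=> jD; pose K := \poly_(i < D.+1) (H`_(D - i) - H`_i).
suff K0 : K = 0.
  have /(congr1 (fun p : {poly R[i]} => p`_j)) := K0.
  by rewrite coef0 coef_poly ltnS jD => /eqP; rewrite subr_eq0 => /eqP.
apply: unit_poly_eq0 => z /(@unit_root _ 2) [//|xi [xi1 <-]].
rewrite horner_poly; under eq_bigr do rewrite mulrBl.
rewrite sumrB -(horner_coef_wide _ size_circle_poly).
have xi1' : xi^J * xi^J^J = 1 by rewrite conjcK mulrC.
have qc : q.@[pt xi^J] = q.@[pt xi].
  apply: q_level; rewrite ?circle_unit ?circle_phi // -rmorphXn.
  by case: (xi ^+ m).
rewrite (reindex_inj rev_ord_inj) /=.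
transitivity ((xi ^+ D) ^+ 2 * H.[xi^J ^+ 2] - H.[xi ^+ 2]).
  congr (_ - _); rewrite (horner_coef_wide _ size_circle_poly) mulr_sumr.
  apply: eq_bigr => -[i ltiD] _ /=; rewrite subSS subKn // mulrCA; congr (_ * _).
  have -> : (xi ^+ D) ^+ 2 = (xi ^+ 2) ^+ (D - i) * (xi ^+ 2) ^+ i.
    by rewrite -exprD subnK // -!exprM mulnC.
  by rewrite -mulrA -exprMn -exprMn xi1 !expr1n mulr1.
rewrite !circle_poly // qc mulrA; apply/eqP; rewrite subr_eq0; apply/eqP.
congr (_ * _); rewrite expr2 -mulrA -exprMn xi1 expr1n; ring.
Qed.

(* Invariance of [Re (xi ^+ m)] under [xi |-> w xi] for a primitive [m]-th root of unity [w]. *)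
Lemma circle_poly_coef j : H`_j != 0 -> j.*2 = D %[mod m].
Proof.
move=> Hj; have jD : (j < D.+1)%N.
  by rewrite ltnNge; apply: contra Hj => h; rewrite nth_default // (leq_trans size_circle_poly).
have [w wm] := @closed_prim_root_exists R[i] m m0.
have w1 : w * w^J = 1.
  apply/eqP; rewrite -(pexpr_eq1 (n := m)) ?mulcJ_ge0 //; apply/eqP.
  have wc : w^J ^+ m = (w ^+ m)^J by rewrite rmorphXn.
  by rewrite exprMn wc (prim_expr_order wm) rmorph1 mulr1.
pose K := \poly_(i < D.+1) (H`_i * w ^+ i.*2 - w ^+ D * H`_i).
have K0 : K = 0.
  apply: unit_poly_eq0 => z /(@unit_root _ 2) [//|xi [xi1 <-]].
  have wxi1 : (w * xi) * (w * xi)^J = 1 by rewrite rmorphM mulrACA w1 xi1 mulr1.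
  have qw : q.@[pt (w * xi)] = q.@[pt xi].
    apply: q_level; rewrite ?circle_unit ?circle_phi //.
    by rewrite exprMn (prim_expr_order wm) mul1r.
  rewrite horner_poly.
  transitivity (H.[(w * xi) ^+ 2] - w ^+ D * H.[xi ^+ 2]).
    rewrite !(horner_coef_wide _ size_circle_poly) mulr_sumr -sumrB.
    apply: eq_bigr => i _; by rewrite -addnn exprD !exprMn; ring.
  by rewrite !circle_poly // qw exprMn mulrA subrr.
have /(congr1 (fun p : {poly R[i]} => p`_j)) := K0.
rewrite coef0 coef_poly jD mulrC -mulrBl => /eqP.
rewrite mulf_eq0 (negbTE Hj) orbF subr_eq0 (eq_prim_root_expr wm) => /eqP.
by [].
Qed.

(** As conj xi is the inverse of xi, the product is xi^(2j - D); its real part depends only on |2j -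
    D|, written here with truncated subtraction. *)
Lemma Re_unit_pow (xi : R[i]) j : xi * xi^J = 1 -> (j <= D)%N ->
  complex.Re ((xi ^+ 2) ^+ j * xi^J ^+ D) = complex.Re (xi ^+ (D - (minn j (D - j)).*2)).
Proof.
move=> xi1 jD; have ReC (z : R[i]) : complex.Re z^J = complex.Re z by case: z.
have [jle|jgt] := leqP j (D - j).
  have -> : D = (j.*2 + (D - j.*2))%N by lia.
  rewrite [in LHS]exprD mulrA -exprM mul2n -exprMn xi1 expr1n mul1r addKn.
  by rewrite -rmorphXn ReC.
have -> : (xi ^+ 2) ^+ j = xi ^+ (D - (D - j).*2) * xi ^+ D.
  by rewrite -exprM -exprD; congr (_ ^+ _); lia.
by rewrite -mulrA -exprMn xi1 expr1n mulr1.
Qed.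

(** Pairing [j] with [D - j] by symmetry replaces xi^(2j - D) by its real part: along the circle [q]
    is a cosine polynomial. *)
Lemma circle_value (xi : R[i]) : xi * xi^J = 1 ->
  q.@[pt xi] = \sum_(j < D.+1) complex.Re H`_j *
     complex.Re (xi ^+ (D - (minn j (D - j)).*2)).
Proof.
move=> xi1; pose c j := (xi ^+ 2) ^+ j * xi^J ^+ D.
have qE : f q.@[pt xi] = \sum_(j < D.+1) H`_j * c j.
  under eq_bigr do rewrite mulrA.
  rewrite -mulr_suml -(horner_coef_wide _ size_circle_poly) circle_poly //.
  by rewrite mulrAC -exprMn xi1 expr1n mul1r.
have cJ j : (j <= D)%N -> c (D - j)%N = (c j)^J.
  move=> jD; rewrite /c rmorphM !rmorphXn /= conjcK.
  have gen (a b e g y : R[i]) : a * b = e * e -> b * g = 1 -> e * y = 1 -> a * y = g * e.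
    move=> ab bg ey; rewrite -[LHS]mulr1 -bg.
    transitivity (a * b * (y * g)); first by ring.
    rewrite ab; transitivity (e * y * (g * e)); first by ring.
    by rewrite ey mul1r.
  apply: (gen _ ((xi ^+ 2) ^+ j)).
  - by rewrite -exprD subnK // -exprM mul2n -addnn exprD.
  - by rewrite -exprMn -exprMn xi1 !expr1n.
  - by rewrite -exprMn xi1 expr1n.
have qE2 : f q.@[pt xi] = \sum_(j < D.+1) H`_j * f (complex.Re (c j)).
  apply: (mulfI (x := 2)); first by rewrite pnatr_eq0.
  rewrite mulr_natl mulr2n {2}qE (reindex_inj rev_ord_inj) /= qE -big_split mulr_sumr.
  apply: eq_bigr => -[j jlt] _ /=; rewrite subSS circle_poly_sym // cJ //.
  by rewrite -mulrDr addcJ mulrCA.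
have ReD : {morph (@complex.Re R) : y z / y + z} by move=> [? ?] [? ?].
transitivity (complex.Re (f q.@[pt xi])); first by [].
rewrite qE2 (big_morph _ ReD (erefl : complex.Re (0 : R[i]) = 0)).
apply: eq_bigr => -[j jlt] _; rewrite -Re_unit_pow // -/(c j).
by rewrite mulrC Re_realM mulrC.
Qed.

(** By [circle_poly_coef] only frequencies |2j - D| = l m survive, and [chebyshev_rep] represents
    each of them; a power of [rho] lifts it to degree D. The sum agrees with [q] on the circle,
    which meets every level set. *)
Lemma sphere_rep_level : exists Q, sphere_rep m phi beta D q Q.
Proof.
have [s [S [hs hS]]] : exists s S, sphere_rep m phi beta D s S /\
    forall xi : R[i], xi * xi^J = 1 -> q.@[pt xi] = S.[phi.@[pt xi]].
  suff [s [S [hs hS]]] : exists s S, sphere_rep m phi beta D s S /\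
     forall xi : R[i], xi * xi^J = 1 -> \sum_(j < D.+1) complex.Re H`_j *
       complex.Re (xi ^+ (D - (minn j (D - j)).*2)) = S.[complex.Re (xi ^+ m)].
    exists s, S; split=> // xi xi1.
    by rewrite circle_value // hS // circle_phi.
  suff : forall k, (k <= D.+1)%N -> exists s S, sphere_rep m phi beta D s S /\
     forall xi : R[i], xi * xi^J = 1 -> \sum_(j < k) complex.Re H`_j *
       complex.Re (xi ^+ (D - (minn j (D - j)).*2)) = S.[complex.Re (xi ^+ m)].
    exact.
  elim=> [_|k IH kD].
    exists 0, 0; split; first exact: srep0.
    by move=> xi _; rewrite big_ord0 horner0.
  have [s [S [hs hS]]] := IH (ltnW kD).
  have [Hk|Hk] := eqVneq H`_k 0.
    exists s, S; split=> // xi xi1.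
    by rewrite big_ord_recr /= Hk mul0r addr0 hS.
  have [l lE] : exists l, (D - (minn k (D - k)).*2 = l * m)%N.
    have := circle_poly_coef Hk => hk; apply/dvdnP.
    have [kle|kgt] := leqP k (D - k).
      by rewrite -eqn_mod_dvd ?hk //; lia.
    have -> : (D - (D - k).*2 = k.*2 - D)%N by lia.
    by rewrite -eqn_mod_dvd ?hk //; lia.
  have [tau [T [hT eT]]] := chebyshev_rep l.
  exists (s + complex.Re H`_k *: (rho ^+ (minn k (D - k)) * tau)),
    (S + complex.Re H`_k *: (1 ^+ (minn k (D - k)) * T)); split.
    apply: srepD => //; apply: srepZ.
    have DE : (minn k (D - k) * 2 + l * m)%N = D by rewrite -lE; lia.
    rewrite -[X in sphere_rep _ _ _ X]DE.
    by apply: srepM hT => //; apply: srepX => //; apply: srep_rho.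
  move=> xi xi1; rewrite big_ord_recr /= hS // lE mulnC exprM eT.
    by rewrite hornerD hornerZ expr1n mul1r.
  by rewrite rmorphXn -exprMn xi1 expr1n.
exists S; suff <- : s = q by [].
have rho0 : (rho : {mpoly R[n]}) != 0.
  have c1 : (1 : R[i]) * 1^J = 1 by rewrite rmorph1 mulr1.
  apply: contraTneq isT => r0; have := circle_unit c1.
  by rewrite r0 meval0 => /eqP; rewrite eq_sym oner_eq0.
apply: (homog_eq_sphere rho0 (srep_homog hs) q_homog) => y y1.
have [xi [xi1 xiy]] := circle_level (phi_le1 y1).
rewrite (srep_val hs y1) -xiy -hS // -(q_level _ y1 xiy) //.
exact: circle_unit.
Qed.

End LevelSets.

(** * A regular point of the sphere, and the proof of the theorem *)

Lemma exists_sphere_regular (R : realType) n m m1 m2 (phi : {mpoly R[n]}) :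
  (0 < n)%N -> (0 < m)%N -> (0 < m1)%N -> (m1 <= m2)%N ->
  (2 * n = (m1 + m2) * m + 4)%N ->
  isoparametric m phi ((m2%:R - m1%:R) / 2 * m%:R ^+ 2) ->
  exists x, rho.@[x] = 1 /\ phi.@[x] ^+ 2 != 1.
Proof.
move=> n0 m0 m10 m12 dim phiP; apply: contrapT => H.
have phi1 x : rho.@[x] = 1 -> phi.@[x] ^+ 2 = 1.
  by move=> x1; apply: contrapT => /eqP h; apply: H; exists x.
have hsq := srepM phiP (srep_phi phiP) (srep_phi phiP).
have hrho := srepX phiP m (srep_rho m phi ((m2%:R - m1%:R) / 2 * m%:R ^+ 2)).
have mmE : (m * 2 = m + m)%N by rewrite muln2 addnn.
(* Equating the Laplacians of the two sides at a unit vector gives (m2 - m1) t = m1 + m2 + 2 with t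
   = 1 or t = -1, which is impossible. *)
have phi2E : phi * phi = rho ^+ m.
  apply: (homog_eq_sphere (rho_neq0 R n0) (srep_homog hsq)).
    by rewrite -mmE; apply: srep_homog hrho.
  by move=> x x1; rewrite mevalM -expr2 phi1 // rmorphXn /= x1 expr1n.
pose x0 (i : 'I_n) : R := (i == Ordinal n0)%:R.
have x01 : rho.@[x0] = 1.
  rewrite meval_rho (bigD1 (Ordinal n0)) //= big1 ?addr0 => [|i /negbTE ni].
    by rewrite /x0 eqxx expr1n.
  by rewrite /x0 ni expr0n.
have := srep_lap hsq x01; rewrite phi2E (srep_lap hrho x01).
have := phi1 _ x01; move: (phi.@[x0]) => t t1.
rewrite expr1n /sphere_lap !(derivM, derivX, derivD, derivC).
rewrite !(hornerD, hornerN, hornerM, hornerC, hornerX, hornerXn) mmE natrD => h.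
have nE : n%:R = (m1%:R + m2%:R) * m%:R / 2 + 2 :> R.
  have /(congr1 (fun k => k%:R : R)) := dim.
  rewrite natrD !natrM natrD => e; apply: (mulfI (x := 2)); first by rewrite pnatr_eq0.
  by rewrite e; field.
have mR : 0 < m%:R :> R by rewrite ltr0n.
have m1R : 0 < m1%:R :> R by rewrite ltr0n.
have m2R : m1%:R <= m2%:R :> R by rewrite ler_nat.
have {h} : m%:R ^+ 2 * ((m2%:R - m1%:R) * t - 2 - (m1%:R + m2%:R)) = 0 :> R.
  have e1 : m%:R ^+ 2 * t ^+ 2 = m%:R ^+ 2 :> R by rewrite t1 mulr1.
  have e2 : m1%:R * m%:R ^+ 2 * t ^+ 2 = m1%:R * m%:R ^+ 2 :> R by rewrite t1 mulr1.
  have e3 : m2%:R * m%:R ^+ 2 * t ^+ 2 = m2%:R * m%:R ^+ 2 :> R by rewrite t1 mulr1.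
  by move: h; rewrite nE; lra.
move/eqP; rewrite mulf_eq0 expf_eq0 /= gt_eqF //= => /eqP.
have /orP[/eqP->|/eqP->] : (t == 1) || (t == -1) by rewrite -sqrf_eq1 t1.
  by lra.
by lra.
Qed.

Theorem theorem5p1 (R : realType) (p : R) (n m m1 m2 : nat) (phi : {mpoly R[n]}) :
  1 < p -> p != 2 ->
  (2 <= n)%N -> (0 < m)%N -> (0 < m1)%N -> (m1 <= m2)%N ->
  (2 * n = (m1 + m2) * m + 4)%N ->
  is_homog m phi ->
  (forall x : 'I_n -> R, ev (gradsq phi) x = (m%:R) ^+ 2 * enorm x ^+ (2 * m - 2)) ->
  (forall x : 'I_n -> R, x != 0 ->
     ev (lap phi) x = (m2%:R - m1%:R) / 2 * (m%:R) ^+ 2 * enorm x ^ (m%:Z - 2)) ->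
  ~ exists (u : {mpoly R[n]}) (d : nat) (f : R * R -> R),
      u != 0 /\ (2 <= d)%N /\ is_homog d u /\
      (forall x : 'I_n -> R, ev (plap p u) x = 0) /\
      C2 f /\
      (forall x : 'I_n -> R, ev u x = f (enorm x ^+ m, ev phi x)).
Proof.
move=> p1 p2 n2 m0 m10 m12 dim hom hgrad hlap [u [d [f [u0 [d2 [homu [pu [_ uf]]]]]]]].
have n0 : (0 < n)%N by apply: leq_trans n2.
have rho0 := rho_neq0 R n0.
have enorm2 (x : 'I_n -> R) : enorm x ^+ 2 = rho.@[x] :> R.
  by rewrite meval_rho sqr_sqrtr // sumr_ge0 // => i _; apply: sqr_ge0.
have enorm1 (x : 'I_n -> R) : rho.@[x] = 1 -> enorm x = 1 :> R.
  by rewrite /enorm -meval_rho => ->; rewrite sqrtr1.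
have phi_grad : mgradprod phi phi = m%:R ^+ 2 *: rho ^+ m.-1.
  apply: mpoly_eq_meval => x; rewrite mevalZ rmorphXn /= -enorm2 -exprM.
  rewrite -[LHS]/(ev (gradsq phi) x) hgrad; congr (_ * _ ^+ _).
  by rewrite -subn1 mulnBr.
set beta := (m2%:R - m1%:R) / 2 * m%:R ^+ 2 : R.
have phiP : isoparametric m phi beta.
  split=> // x x1.
    by rewrite phi_grad mevalZ rmorphXn /= x1 expr1n mulr1.
  rewrite -[LHS]/(ev (lap phi) x) hlap.
    by rewrite (enorm1 _ x1) exp1rz mulr1.
  apply: contra_eq_neq x1 => ->; rewrite meval_rho big1 => [|i _].
    by rewrite eq_sym oner_eq0.
  by rewrite expr0n.
have [x0 [x01 x0r]] := exists_sphere_regular n0 m0 m10 m12 dim phiP.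
have [kappa circle] := exists_isoparametric_circle m0 hom phi_grad x01 x0r.
have phi_le1 x : rho.@[x] = 1 -> phi.@[x] ^+ 2 <= 1.
  by move=> x1; apply: (isoparametric_le1 m0 hom phi_grad x1).
have rep D q := @sphere_rep_level R n m phi beta m0 phiP kappa circle D q.
have ueq x y : rho.@[x] = 1 -> rho.@[y] = 1 -> phi.@[x] = phi.@[y] -> u.@[x] = u.@[y].
  move=> x1 y1 xy; rewrite -[LHS]/(ev u x) -[RHS]/(ev u y) !uf !enorm1 //.
  by rewrite /ev xy.
have [G hG] := rep _ _ homu ueq phi_le1.
pose P := (d%:R ^+ 2)%:P * G ^+ 2 + (m%:R ^+ 2)%:P * (1 - 'X^2) * G^`() ^+ 2.
have wE x : rho.@[x] = 1 -> (mgradprod u u).@[x] = P.[phi.@[x]].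
  move=> x1; rewrite (mgradprod_rep phiP hG hG x1) /P.
  rewrite !(horner_exp, hornerD, hornerN, hornerM, hornerC, hornerX); ring.
have homw : mgradprod u u \is (d.-1 + d.-1).-homog.
  by apply: rpred_sum => i _; apply: dhomogM; apply: dhomog_mderiv.
have weq x y : rho.@[x] = 1 -> rho.@[y] = 1 -> phi.@[x] = phi.@[y] ->
    (mgradprod u u).@[x] = (mgradprod u u).@[y].
  by move=> x1 y1 xy; rewrite !wE // xy.
(* [wE] gives only the values of |grad u|^2, while the p-Laplacian needs its gradient. Being
   constant on level sets, it has a full representation, whose profile must be [P]. *)
have [P' hP'] := rep _ _ homw weq phi_le1.
have PE : P' = P.
  apply/eqP; rewrite -subr_eq0; apply/eqP.
  apply: (level_poly_eq0 m0 circle) => x x1.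
  by rewrite hornerD hornerN -(srep_val hP' x1) wE // subrr.
rewrite {P'}PE in hP'.
suff G0 : G = 0.
  have hom0 : (0 : {mpoly R[n]}) \is d.-homog by apply: dhomog0.
  case/eqP: u0; apply: (homog_eq_sphere rho0 homu hom0) => x x1.
  by rewrite (srep_val hG x1) G0 horner0 meval0.
apply: (@cone_ode_eq0 R p n m m1 m2 d G p1 p2 m0 m10 m12 dim d2).
rewrite -/beta -/P.
apply: (level_poly_eq0 m0 circle) => x x1.
have dE : (d.-1 + d.-1)%:R = 2 * (d%:R - 1) :> R.
  by rewrite -subn1 natrD natrB ?(ltnW d2) //; ring.
have := pu x; rewrite /ev /plap mevalD mevalM mevalZ.
rewrite -[gradsq u]/(mgradprod u u) -[lap u]/(mlap u).
rewrite -[\sum_(j < n) _]/(mgradprod u (mgradprod u u)).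
rewrite (mgradprod_rep phiP hG hP' x1) (srep_val hP' x1) (srep_lap hG x1) dE => h.
rewrite -[RHS]h !(hornerD, hornerN, hornerM, hornerC, hornerX, horner_exp); ring.
Qed.
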